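(* Assume Assumption A1 (stated in the context). Let $h,r,M$ be positive constants, put $\lambda=h^{2m}$, and suppose $c_K^2\sqrt{M}\,r\,h^{-1/2}A(h)\le 1/2$. Then $$\sup_{f\in H^m(1)}P_f\Big(\|\widehat f_{n,\lambda}-f\|\ge \delta_n(M,r)\Big)\le 2\exp(-Mnhr^2),$$ where $\delta_n(M,r)=2h^m+c_K\big(\sqrt{2M}\,r+(nh)^{-1/2}\big)$.
   Context: Fix an integer $m\ge1$ and $\mathbb{I}=[0,1]$. $S^m(\mathbb{I})$ is the Sobolev space of $f\in L^2(\mathbb{I})$ such that $f^{(j)}$ is absolutely continuous for $j=0,\dots,m-1$ and $\int_0^1|f^{(m)}(x)|^2dx<\infty$. Data $(Y_i,X_i)$, $i=1,\dots,n$, are i.i.d. copies of $(Y,X)$ with $Y=f(X)+\epsilon$, where $X\sim\mathrm{Unif}[0,1]$, $\epsilon\sim N(0,1)$ is independent of $X$, and $f\in S^m(\mathbb{I})$; $P_f$ denotes probability when $f$ is the true regression function, and $\epsilon_i=Y_i-f(X_i)$. Let $J(f,g)=\int_0^1f^{(m)}(x)g^{(m)}(x)dx$ and $V(f,g)=E\{f(X)g(X)\}$. For $\lambda>0$ let $\langle f,g\rangle=V(f,g)+\lambda J(f,g)$ with norm $\|\cdot\|$; $(S^m(\mathbb{I}),\langle\cdot,\cdot\rangle)$ is a reproducing kernel Hilbert space with kernel $K$, $K_x=K(x,\cdot)$, $\langle K_x,f\rangle=f(x)$. The smoothing spline estimator is $\widehat f_{n,\lambda}=\arg\max_{f\in S^m(\mathbb{I})}\{-\frac{1}{2n}\sum_{i=1}^n(Y_i-f(X_i))^2-\frac{\lambda}{2}J(f,f)\}$.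 Assumption A1: there exist $\varphi_\nu\in S^m(\mathbb{I})$, $\nu\ge1$, with $\sup_{\nu}\|\varphi_\nu\|_{\sup}<\infty$, and a nondecreasing sequence $\rho_\nu$ with $\rho_\nu/(c_\rho\nu)^{2m}\to1$ for some constant $c_\rho>0$, such that $V(\varphi_\mu,\varphi_\nu)=\delta_{\mu\nu}$, $J(\varphi_\mu,\varphi_\nu)=\rho_\mu\delta_{\mu\nu}$, and every $g\in S^m(\mathbb{I})$ satisfies $g=\sum_\nu V(g,\varphi_\nu)\varphi_\nu$ with convergence in $\|\cdot\|$. With $h=\lambda^{1/(2m)}$, let $c_K=\sup_{x\in\mathbb{I}}\sqrt{hK(x,x)}$ (finite under A1), $H^m(1)=\{f\in S^m(\mathbb{I}):J(f,f)\le1\}$, $\mathcal{G}=\{g\in S^m(\mathbb{I}):\|g\|_{\sup}\le1,\ J(g,g)\le c_K^{-2}h^{-2m+1}\}$, and let $c_0>0$ be a constant such that $\log N(\varepsilon,\mathcal{G},\|\cdot\|_{\sup})\le c_0h^{-(2m-1)/(2m)}\varepsilon^{-1/m}$ for all $\varepsilon>0$, where $N$ is the $\varepsilon$-packing number. Let $\tau=\sqrt{\log1.5}$, $\Psi(r)=\int_0^r\sqrt{\log(1+\exp(x^{-1/m}))}\,dx$, $$A(h,\varepsilon)=\frac{32\sqrt6}{\tau}c_K^{-1}c_0^mh^{-(2m-1)/2}\Psi\Big(\tfrac12c_Kc_0^{-m}h^{(2m-1)/2}\varepsilon\Big)+\frac{20\sqrt6\,\varepsilon}{\tau}\sqrt{\log\Big(1+\exp\big(2c_0(c_Kh^{(2m-1)/2}\varepsilon)^{-1/m}\big)\Big)},$$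 and $A(h)=A(h,2)$. *)

(* Defs.v *)
From HB Require Import structures.
From mathcomp Require Import all_boot all_order all_algebra.
From mathcomp Require Import all_classical all_reals all_analysis.
From mathcomp Require Import normal_distribution uniform_distribution.
Set Implicit Arguments. Unset Strict Implicit. Unset Printing Implicit Defensive.
Import Order.TTheory GRing.Theory Num.Theory.
Import numFieldNormedType.Exports.
Local Open Scope classical_set_scope.
Local Open Scope ring_scope.

Section Defs.
Variable R : realType.
Notation mu := (@lebesgue_measure R).

Definition abs_cont01 (f : R -> R) : Prop :=
  forall eps : R, 0 < eps -> exists2 delta : R, 0 < delta &
    forall (k : nat) (a b : nat -> R),
      (forall i, (i < k)%N -> 0 <= a i /\ a i <= b i /\ b i <= 1) ->
      (forall i j, (i < j)%N -> (j < k)%N -> b i <= a j) ->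
      \sum_(i < k) (b i - a i) < delta ->
      \sum_(i < k) `|f (b i) - f (a i)| < eps.

Definition sob_witness (m : nat) (f : R -> R) (d : nat -> R -> R) : Prop :=
  [/\ (forall x, x \in `[0, 1] -> d 0%N x = f x),
      (forall j, (j < m)%N -> abs_cont01 (d j)),
      (forall j, (j < m)%N -> {ae mu, forall x, x \in `]0, 1[ ->
          derivable (d j) x 1 /\ derive1 (d j) x = d j.+1 x}) &
      mu.-integrable `[0, 1] (fun x => ((d m x) ^+ 2)%:E)].

Definition Sobolev (m : nat) (f : R -> R) : Prop := exists d, sob_witness m f d.

Definition Dm (m : nat) (f : R -> R) : R -> R :=
  match pselect (Sobolev m f) with
  | left H => projT1 (cid H) m
  | right _ => fun _ => 0
  end.

Definition Jf (m : nat) (f g : R -> R) : R :=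
  Rintegral mu `[0, 1] (fun x => Dm m f x * Dm m g x).

(* V(f,g) = E f(X) g(X), X ~ Unif[0,1] *)
Definition Vf (f g : R -> R) : R := Rintegral mu `[0, 1] (fun x => f x * g x).

Definition inner (m : nat) (lam : R) (f g : R -> R) : R := Vf f g + lam * Jf m f g.
Definition snorm (m : nat) (lam : R) (f : R -> R) : R := Num.sqrt (inner m lam f f).

Definition supnorm01 (f : R -> R) : R := sup [set `|f x| | x in `[0, 1]].

Definition A1 (m : nat) (lam : R) : Prop :=
  exists (phi : nat -> R -> R) (rho : nat -> R) (crho : R),
  0 < crho /\
      (forall nu, Sobolev m (phi nu)) /\
      (exists B : R, forall nu x, x \in `[0, 1] -> `|phi nu x| <= B) /\
      (forall mu nu, (mu <= nu)%N -> rho mu <= rho nu) /\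
      ((fun nu : nat => rho nu / (crho * nu.+1%:R) ^+ (2 * m)) @ \oo --> (1 : R)) /\
      (forall mu nu, Vf (phi mu) (phi nu) = (mu == nu)%:R) /\
      (forall mu nu, Jf m (phi mu) (phi nu) = rho mu * (mu == nu)%:R) /\
      (forall g, Sobolev m g ->
        (fun N : nat => snorm m lam
            (g \- (fun x => \sum_(nu < N) Vf g (phi nu) * phi nu x)))
          @ \oo --> (0 : R)).
(* (phi nu, rho nu) here stands for (phi_(nu+1), rho_(nu+1)) of the paper. *)

Definition reproducing_kernel (m : nat) (lam : R) (K : R -> R -> R) : Prop :=
  forall x, x \in `[0, 1] ->
    Sobolev m (K x) /\ (forall f, Sobolev m f -> inner m lam (K x) f = f x).

Definition cK (h : R) (K : R -> R -> R) : R :=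
  sup [set Num.sqrt (h * K x x) | x in `[0, 1]].

Definition Gclass (m : nat) (h cK : R) (g : R -> R) : Prop :=
  [/\ Sobolev m g, supnorm01 g <= 1 &
      Jf m g g <= cK ^- 2 * h `^ (- (2 * m%:R - 1))].

(* log N(eps, G, ||.||_sup) <= c0 h^(-(2m-1)/(2m)) eps^(-1/m):
   every eps-separated (distinct elements at sup-distance > eps)
   finite family in G has log-cardinality bounded as stated. *)
Definition entropy_const (m : nat) (h cK c0 : R) : Prop :=
  forall eps : R, 0 < eps -> forall s : seq (R -> R),
    (forall i, (i < size s)%N -> Gclass m h cK (nth (fun=> 0) s i)) ->
    (forall i j, (i < j)%N -> (j < size s)%N ->
       eps < supnorm01 (nth (fun=> 0) s i \- nth (fun=> 0) s j)) ->
    ln (size s)%:R <= c0 * h `^ (- ((2 * m%:R - 1) / (2 * m%:R))) * eps `^ (- m%:R^-1).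

Definition Psi (m : nat) (r : R) : R :=
  Rintegral mu `[0, r] (fun x => Num.sqrt (ln (1 + expR (x `^ (- m%:R^-1))))).

Definition tau : R := Num.sqrt (ln (3 / 2)).

Definition Ahe (m : nat) (cK c0 h eps : R) : R :=
  32 * Num.sqrt 6 / tau * cK^-1 * c0 ^+ m * h `^ (- ((2 * m%:R - 1) / 2))
    * Psi m (2^-1 * cK * c0 ^- m * h `^ ((2 * m%:R - 1) / 2) * eps)
  + 20 * Num.sqrt 6 * eps / tau
    * Num.sqrt (ln (1 + expR (2 * c0 * (cK * h `^ ((2 * m%:R - 1) / 2) * eps) `^ (- m%:R^-1)))).

Definition objective (m n : nat) (lam : R) (Y X : 'I_n -> R) (f : R -> R) : R :=
  - (2 * n%:R)^-1 * \sum_(i < n) (Y i - f (X i)) ^+ 2 - lam / 2 * Jf m f f.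

Definition delta_n (m n : nat) (h cK M r : R) : R :=
  2 * h ^+ m + cK * (Num.sqrt (2 * M) * r + (n%:R * h) `^ (- 2^-1)).

Definition outerP d (T : measurableType d) (P : probability T R) (E : set T) : \bar R :=
  ereal_inf [set P A | A in [set A | measurable A /\ E `<=` A]].

Definition mutually_independent d (T : measurableType d) (P : probability T R)
  (I : finType) (Z : I -> T -> R) : Prop :=
  forall (S : {set I}) (B : I -> set R), (forall i, measurable (B i)) ->
    P [set w | forall i, i \in S -> B i (Z i w)] =
    (\prod_(i in S) fine (P (Z i @^-1` B i)))%:E.

End Defs.

(* Main.v *)
(**
With [lam = h^(2m)] and [kap2 = cK^2 / h], every [g] in the Sobolev space satisfies
[g(x)^2 <= kap2 |g|^2] on [[0, 1]].  Let [D] be the error of the estimator.  Comparing the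
objective at the estimator and at [f] gives
  [P_n D^2 + lam J(D, D) <= (1/n) sum_i eps_i D(X_i) - lam J(f, D)],
where [P_n] is the empirical mean.  In the orthonormal basis [psi_nu] obtained from A1, the
left-hand side is at least [(1 - eta) |D|^2] once the empirical second-moment operator is
within [eta] of its expectation in Hilbert-Schmidt norm, and the right-hand side is at most
[(W + h^m) |D|] with [W^2 = sum_nu ((1/n) sum_i eps_i psi_nu(X_i))^2].

The two random quantities are controlled directly, without chaining: since [A(h) >= 80],
the smallness hypothesis bounds [kap2 r sqrt(M h)] by [1/160].  The operator deviation is a sum of i.i.d. centred bounded vectors, handled by the
exponential moment of [sqrt(1 + |S|^2)].  Given the design, [exp(c W^2)] is integrated one
Gaussian variable at a time: each integration is a rank-one update [B -> B - v^T v] of the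
inverse of the matrix of the quadratic form.  With [eta = 1/10] the constants lost are
recovered from [kap2 >= 3] when [lam < 1/27] (evaluate [6 x - 2] at 1), and from the
bias term [2 h^m] otherwise.  Infinite sums over [nu] are limits of increasing events.
*)

(* The estimator [fhat] is arbitrary as a function of the data, so the event need not be measurable;
   hence the outer probability, and hence the plan of a deterministic error bound valid outside one
   measurable set built from [X] and [eps] alone. Measuring both fluctuations by Hilbert norms makes
   that bound uniform over all candidate functions: Cauchy-Schwarz replaces a supremum over a
   function class. The price is infinitely many coordinates, so each tail bound has to be free of
   the truncation level [N]; the trace bound [sum_nu psi_nu(x)^2 <= kap2] makes this possible. For
   the operator, the operator norm would be enough, but the Hilbert-Schmidt norm is again a Hilbert
   norm, so that an exponential moment of a sum of vectors controls it.

   With [rho = M n h r^2] and [L = delta_n - 2 h^m] one has [n L^2 = kap2 (1 + sqrt (2 rho))^2], and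
   the smallness hypothesis implies [160^2 kap2^2 rho <= n]. Each of the two bad events then has
   probability at most [exp (- rho)], whence the factor 2 of the claim. *)
Require Import Defs.
From HB Require Import structures.
From mathcomp Require Import all_boot all_order all_algebra.
From mathcomp Require Import all_classical all_reals all_analysis.
From mathcomp Require Import normal_distribution uniform_distribution.
From mathcomp Require Import measurable_realfun ring lra zify.
Set Implicit Arguments. Unset Strict Implicit. Unset Printing Implicit Defensive.
Import Order.TTheory GRing.Theory Num.Theory.
Import numFieldNormedType.Exports.
Local Open Scope classical_set_scope.
Local Open Scope ring_scope.

(** * Independence of finite families and iterated integrals *)

Section IndependentPiSystems.
Context {R : realType} {d : measure_display} {T : measurableType d}.
Variable P : probability T R.
Variables G H : set (set T).
Hypotheses (mG : G `<=` measurable) (mH : H `<=` measurable).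
Hypotheses (GI : setI_closed G) (HI : setI_closed H).
Hypotheses (GT : G setT) (HT : H setT).
Hypothesis GHindep : forall A B, G A -> H B -> P (A `&` B) = (P A * P B)%E.

Local Open Scope ereal_scope.

Lemma g_sigma_sub (E : set (set T)) : E `<=` measurable ->
  <<s E >> `<=` measurable.
Proof. by move=> mE; exact: smallest_sub (sigma_algebra_measurable T) mE. Qed.

(** For fixed [B], the finite measures [A -> P (A & B)] and [A -> P A * P B] agree on the pi-system
    [E], hence on the sigma-algebra that it generates. Applying this to each factor in turn gives
    [independent_g_sigma]. *)
Lemma independent_extend_left (E F : set (set T)) :
  E `<=` measurable -> F `<=` measurable -> setI_closed E -> E setT ->
  (forall A B, E A -> F B -> P (A `&` B) = P A * P B) ->
  forall A B, <<s E >> A -> F B -> P (A `&` B) = P A * P B.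
Proof.
move=> mE mF EI ET EF A B sA FB.
have mB := mF _ FB.
have PB0 : (0 <= fine (P B))%R by rewrite fine_ge0.
pose m1 := mrestr P mB.
pose m2 := mscale (NngNum PB0) P.
have H12 : forall C, E C -> m1 C = m2 C.
  move=> C EC; rewrite /m1 /m2 /mrestr /mscale /= EF// muleC fineK//.
  exact: fin_num_measure.
have m1oo k : m1 ((fun _ : nat => [set: T]) k) < +oo.
  rewrite /m1 /mrestr setTI.
  by apply: le_lt_trans (probability_le1 _ mB) _; rewrite ltry.
have ETT : \bigcup_k ((fun _ : nat => [set: T]) k) = setT.
  by rewrite bigcup_const//; exists 0%N.
have := @g_sigma_algebra_measure_unique _ _ _ E mE (fun=> setT) (fun=> ET) ETT
  m1 m2 EI H12 m1oo A sA.
move=> m12; apply: (eq_trans m12); rewrite /m2 /mscale muleC; congr (_ * _).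
by rewrite /= fineK// fin_num_measure.
Qed.

Lemma independent_g_sigma A B : <<s G >> A -> <<s H >> B ->
  P (A `&` B) = P A * P B.
Proof.
move=> sA sB; rewrite setIC muleC.
apply: (@independent_extend_left H (<<s G >>)) => // [|C D HC sD].
  exact: g_sigma_sub.
rewrite setIC muleC.
exact: (@independent_extend_left G H).
Qed.

Notation TG := (g_sigma_algebraType G).
Notation TH := (g_sigma_algebraType H).

Lemma measurable_idG : measurable_fun setT (idfun : T -> TG).
Proof. by move=> _ A /= sA; rewrite setTI; exact: g_sigma_sub sA. Qed.

Lemma measurable_idH : measurable_fun setT (idfun : T -> TH).
Proof. by move=> _ A /= sA; rewrite setTI; exact: g_sigma_sub sA. Qed.

Lemma measurable_diag : measurable_fun setT (fun t : T => (t : TG, t : TH)).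
Proof.
apply: measurable_fun_pair; [exact: measurable_idG|exact: measurable_idH].
Qed.

(** Independence says exactly that the diagonal map [t -> (t, t)], into two copies of [T] carrying
    the two sub-sigma-algebras, pushes [P] to a product measure. Tonelli on that product then
    separates the two roles of [t], without introducing any joint law of the variables. *)
Lemma integral_diag (F : TG * TH -> \bar R) :
  measurable_fun [set: (TG * TH)%type] F ->
  (forall x, 0 <= F x) ->
  \int[P]_t F (t, t) = \int[P]_t \int[P]_u F (t, u).
Proof.
move=> mF F0.
pose XG : {mfun T >-> TG} := mfun_Sub (mem_set measurable_idG).
pose XH : {mfun T >-> TH} := mfun_Sub (mem_set measurable_idH).
pose D : {mfun T >-> (TG * TH)%type} := mfun_Sub (mem_set measurable_diag).
pose PG : probability TG R := distribution P XG.
pose PH : probability TH R := distribution P XH.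
have PD : forall X, measurable X -> (PG \x PH) X = distribution P D X.
  apply: product_measure_unique => A B sA sB.
  exact: independent_g_sigma.
transitivity (\int[distribution P D]_x F x).
  by rewrite ge0_integral_distribution.
transitivity (\int[PG \x PH]_x F x).
  by apply: eq_measure_integral => A mA _; exact/esym/PD.
rewrite fubini_tonelli1// ge0_integral_distribution//; last 2 first.
- exact: measurable_fun_fubini_tonelli_F.
- by move=> x; apply: integral_ge0 => y _; exact: F0.
apply: eq_integral => t _; rewrite /fubini_F /=.
rewrite ge0_integral_distribution//.
exact: measurableT_comp mF (measurable_pair1 _).
Qed.

End IndependentPiSystems.

Section IndependentFamilies.
Context {R : realType} {d : measure_display} {T : measurableType d}.
Variable P : probability T R.
Context {I : finType} (Z : I -> T -> R).
Hypothesis mZ : forall i, measurable_fun setT (Z i).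
Hypothesis indepZ : mutually_independent P Z.

(** A pi-system generating the sigma-algebra of the coordinates in [S]. *)
Definition cylinders (S : {set I}) : set (set T) :=
  [set A | exists2 B : I -> set R, (forall i, measurable (B i)) &
     A = [set w | forall i, i \in S -> B i (Z i w)]].

Lemma measurable_cylinders S : cylinders S `<=` measurable.
Proof.
move=> _ [B mB ->].
rewrite (_ : mkset _ = \bigcap_(i in [set i | i \in S]) (Z i @^-1` B i)); last first.
  by apply/seteqP; split => [w Bw i /= iS|w Bw i iS]; [exact: Bw|exact: (Bw i)].
apply: fin_bigcap_measurable => // i _.
by rewrite -[X in measurable X]setTI; exact: mZ.
Qed.

Lemma setI_closed_cylinders S : setI_closed (cylinders S).
Proof.
move=> _ _ [B mB ->] [C mC ->]; exists (fun i => B i `&` C i).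
  by move=> i; exact: measurableI.
apply/seteqP; split => [w [Bw Cw] i iS|w BCw]; first by split; [exact: Bw|exact: Cw].
by split => i iS; have [] := BCw i iS.
Qed.

Lemma cylindersT S : cylinders S setT.
Proof. by exists (fun=> setT) => //; apply/seteqP; split. Qed.

Lemma measurable_cylinderfun (S : {set I}) i : i \in S ->
  measurable_fun [set: g_sigma_algebraType (cylinders S)] (Z i).
Proof.
move=> iS _ B mB; rewrite setTI; apply: sub_sigma_algebra.
exists (fun j => if j == i then B else setT); first by move=> j; case: ifP.
apply/seteqP; split => [w Bw j jS|w Bw]; last by have := Bw _ iS; rewrite eqxx.
by case: eqP => [->|].
Qed.

Local Open Scope ereal_scope.

Lemma independent_cylinders (S1 S2 : {set I}) A1 A2 : (forall i, i \in S2 -> i \in S1 = false) ->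
  cylinders S1 A1 -> cylinders S2 A2 -> P (A1 `&` A2) = P A1 * P A2.
Proof.
move=> S12 [B1 mB1 ->] [B2 mB2 ->].
(* Gluing the two families turns the intersection into a single cylinder over the union, to which
   [indepZ] applies. *)
pose B i := if i \in S1 then B1 i else B2 i.
have mB i : measurable (B i) by rewrite /B; case: ifP.
rewrite (_ : _ `&` _ = [set w | forall i, i \in S1 :|: S2 -> B i (Z i w)]); last first.
  apply/seteqP; split => [w [B1w B2w] i|w Bw].
    rewrite inE /B; case: ifPn => [iS1 _|_ /= iS2]; [exact: B1w|exact: B2w].
  split => i iS.
    by have := Bw i; rewrite inE iS /B iS; exact.
  by have := Bw i; rewrite inE iS orbT /B S12//; exact.
rewrite !indepZ// -EFinM; congr EFin.
rewrite (big_setID S1)/=; congr (_ * _)%R; last first.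
  apply: eq_big => i; rewrite !inE.
    by case: (boolP (i \in S2)) => [/S12 ->|_]; rewrite ?orbT ?orbF ?andNb.
  by move=> /andP[/negbTE iS _]; rewrite /B iS.
apply: eq_big => i; rewrite !inE; first by case: (i \in S1); rewrite ?andbF.
by move=> /andP[_ iS]; rewrite /B iS.
Qed.

(** The working form of conditioning: the variables of one block are frozen while those of a
    disjoint block are integrated. *)
Lemma integral_disjoint (S1 S2 : {set I}) (F : T -> T -> \bar R) :
  (forall i, i \in S2 -> i \in S1 = false) ->
  measurable_fun [set: (g_sigma_algebraType (cylinders S1) *
                        g_sigma_algebraType (cylinders S2))%type]
    (fun x => F x.1 x.2) ->
  (forall t u, 0 <= F t u) ->
  \int[P]_t F t t = \int[P]_t \int[P]_u F t u.
Proof.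
move=> S12 mF F0.
apply: (@integral_diag _ _ _ P (cylinders S1) (cylinders S2)
  (@measurable_cylinders S1) (@measurable_cylinders S2)
  (@setI_closed_cylinders S1) (@setI_closed_cylinders S2) (@cylindersT S1) (@cylindersT S2)
  _ (fun x => F x.1 x.2)) => //.
by move=> A B; exact: independent_cylinders.
Qed.

End IndependentFamilies.

(** * Exponential moments of the norm of a sum of bounded vectors *)

Section RealInequalities.
Context {R : realType}.
Implicit Types (a b c x y u : R).

Lemma discriminant_le a b c : 0 <= a ->
  (forall t, 0 <= a * t ^+ 2 + 2 * b * t + c) -> b ^+ 2 <= a * c.
Proof.
move=> ap H; have c0 : 0 <= c by have := H 0; rewrite expr0n/= !mulr0 !add0r.
have [a0|a0] := eqVneq a 0.
  have [->|b0] := eqVneq b 0; first by rewrite expr0n mulr_ge0.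
  have := H (- (c + 1) / (2 * b)); rewrite a0 !mul0r add0r.
  by rewrite mulrCA mulfV ?mulr1 ?mulf_neq0//; lra.
have := H (- b / a).
have -> : a * (- b / a) ^+ 2 + 2 * b * (- b / a) + c = (a * c - b ^+ 2) / a.
  by field.
by rewrite pmulr_lge0 ?invr_gt0 ?lt_neqAle 1?eq_sym ?a0// subr_ge0.
Qed.

(** From [exp (- x) >= 1 - x] one gets [exp x <= 1 / (1 - x)], and [(1 + x + 2 x^2) (1 - x) - 1 =
    x^2 (1 - 2 x)] is nonnegative here. *)
Lemma expR_le_quadratic x : `|x| <= 2^-1 -> expR x <= 1 + x + 2 * x ^+ 2.
Proof.
rewrite ler_norml => /andP[x1 x2].
have := expR_ge1Dx (- x); rewrite expRN => H.
have x0 : 0 < 1 - x by lra.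
have : expR x <= (1 - x)^-1 by rewrite -[expR x]invrK lef_pV2// posrE// invr_gt0 expR_gt0.
move/le_trans; apply; rewrite -div1r ler_pdivrMr//.
have : 0 <= x ^+ 2 * (1 - 2 * x) by rewrite mulr_ge0 ?sqr_ge0//; lra.
lra.
Qed.

(** The right-hand side is the tangent of the square root at [u ^ 2]. *)
Lemma sqrt_le_mean x u : 0 < u -> 0 <= x -> Num.sqrt x <= (x + u ^+ 2) / (2 * u).
Proof.
move=> u0 x0; rewrite ler_pdivlMr ?mulr_gt0//.
have := sqr_ge0 (Num.sqrt x - u); have := sqr_sqrtr x0.
nra.
Qed.

Lemma cauchy_schwarz_sum (J : finType) (p q : J -> R) :
  (\sum_j p j * q j) ^+ 2 <= (\sum_j p j ^+ 2) * (\sum_j q j ^+ 2).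
Proof.
apply: discriminant_le => [|t]; first by apply: sumr_ge0 => j _; exact: sqr_ge0.
have -> : (\sum_j p j ^+ 2) * t ^+ 2 + 2 * (\sum_j p j * q j) * t + \sum_j q j ^+ 2
   = \sum_j (p j * t + q j) ^+ 2.
  rewrite mulr_suml -mulrA mulr_suml mulr_sumr -!big_split/=.
  by apply: eq_bigr => j _; ring.
by apply: sumr_ge0 => j _; exact: sqr_ge0.
Qed.

End RealInequalities.

Section NormMGF.
Context {R : realType} {J : finType}.
Implicit Types s z : J -> R.

Definition sqn s := \sum_j s j ^+ 2.

Lemma sqn_ge0 s : 0 <= sqn s.
Proof. by apply: sumr_ge0 => j _; exact: sqr_ge0. Qed.

(** The [1 +] keeps the radius at least 1, so that dividing by it in the first-order expansion is
    harmless even near [s = 0]. *)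
Definition expnorm s := expR (Num.sqrt (1 + sqn s)).

(* [sqrt] is concave, so [|s + z|] grows at first order only by [<s, z> / u] with
   [u = sqrt (1 + |s|^2)]; that term has mean zero when [z] is centred. *)
Lemma expnorm_step (beta : R) s z : beta <= 2^-1 -> 0 <= beta ->
  sqn z <= beta ^+ 2 ->
  expnorm (fun j => s j + z j) <=
  expnorm s * expR (beta ^+ 2 / 2) *
  (1 + 2 * beta ^+ 2 + \sum_j (s j / Num.sqrt (1 + sqn s)) * z j).
Proof.
move=> b2 b0 zb.
set u := Num.sqrt (1 + sqn s).
have sg := sqn_ge0 s.
have u2 : u ^+ 2 = 1 + sqn s by rewrite sqr_sqrtr//; lra.
have u1 : 1 <= u by rewrite -sqrtr1 ler_sqrt; lra.
have u0 : 0 < u by lra.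
set x := \sum_j _.
have sx : \sum_j s j * z j = u * x.
  by rewrite mulr_sumr; apply: eq_bigr => j _; rewrite mulrA mulrCA mulfV ?mulr1// gt_eqF.
have sz : sqn (fun j => s j + z j) = sqn s + 2 * (u * x) + sqn z.
  rewrite -sx mulr_sumr -!big_split/=; apply: eq_bigr => j _; ring.
have xb : x ^+ 2 <= beta ^+ 2.
  have := cauchy_schwarz_sum s z; rewrite sx -/(sqn s) -/(sqn z) exprMn u2 => H.
  rewrite -(ler_pM2l (_ : 0 < 1 + sqn s)); last by lra.
  apply: (le_trans H); apply: ler_pM => //; [exact: sqn_ge0|lra].
have xh : `|x| <= 2^-1.
  have : `|x| <= beta by rewrite -(ler_pXn2r (_ : (0 < 2)%N)) ?nnegrE// real_normK// num_real.
  lra.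
rewrite /expnorm -/u sz.
have zg := sqn_ge0 z.
have szg := sqn_ge0 (fun j => s j + z j); rewrite sz in szg.
have H1 : Num.sqrt (1 + (sqn s + 2 * (u * x) + sqn z)) <= u + beta ^+ 2 / 2 + x.
  apply: le_trans (sqrt_le_mean u0 _) _; first by lra.
  rewrite ler_pdivrMr ?mulr_gt0//.
  have : sqn z <= u * beta ^+ 2.
    by apply: (le_trans zb); rewrite ler_peMl// sqr_ge0//.
  have -> : (u + beta ^+ 2 / 2 + x) * (2 * u)
    = 2 * u ^+ 2 + u * beta ^+ 2 + 2 * (u * x) by field.
  rewrite u2; lra.
apply: le_trans (_ : expR (u + beta ^+ 2 / 2 + x) <= _); first by rewrite ler_expR.
rewrite !expRD ler_pM2l ?mulr_gt0 ?expR_gt0//.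
by apply: le_trans (expR_le_quadratic xh) _; lra.
Qed.

End NormMGF.

Lemma measurable_gt_set {R : realType} d (T : measurableType d) (f : T -> R) (a : R) :
  measurable_fun setT f -> measurable [set t | a < f t].
Proof.
move=> mf; rewrite -[X in measurable X]setTI.
have := measurable_fun_ltr (@measurable_cst _ _ _ _ setT a) mf.
by move=> /(_ measurableT [set true]); rewrite /preimage/=; apply.
Qed.

Lemma measurable_sum_seq {R : realType} d (T : measurableType d) (D : set T)
    (I : eqType) (s : seq I) (h : I -> T -> R) :
  (forall i, i \in s -> measurable_fun D (h i)) ->
  measurable_fun D (fun x => \sum_(i <- s) h i x).
Proof.
elim: s => [|i s IH] mh; first by under eq_fun do rewrite big_nil; exact: measurable_cst.
under eq_fun do rewrite big_cons.
apply: measurable_funD; first by apply: mh; rewrite mem_head.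
by apply: IH => k ks; apply: mh; rewrite inE ks orbT.
Qed.

Lemma measurable_sqrt {R : realType} : measurable_fun setT (@Num.sqrt R).
Proof. exact: continuous_measurable_fun (@sqrt_continuous R). Qed.

Lemma measurable_expnorm {R : realType} d (T : measurableType d) (J : finType)
    (f : T -> J -> R) : (forall j, measurable_fun setT (f ^~ j)) ->
  measurable_fun setT (fun t => expnorm (f t)).
Proof.
move=> mf; apply: measurableT_comp => //; apply: measurableT_comp.
  exact: measurable_sqrt.
apply: measurable_funD => //; apply: measurable_sum => j.
exact: measurable_funX.
Qed.

Section ProbabilityIntegrals.
Context {R : realType} d (T : measurableType d) (P : probability T R).
Local Open Scope ereal_scope.

Lemma bounded_integrable_prob (f : T -> R) (B : R) : measurable_fun setT f ->
  (forall t, `|f t| <= B)%R -> P.-integrable setT (EFin \o f).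
Proof.
move=> mf fB; apply: measurable_bounded_integrable => //.
  by apply: (@le_lt_trans _ _ 1); [exact: probability_le1|rewrite ltry].
exists B; split; first by rewrite num_real.
by move=> x Bx t _; apply: (le_trans (fB t)); exact: ltW.
Qed.

Lemma integral_affine_centred (J : finType) (Y : J -> T -> R) (B a : R) (b : J -> R) :
  (forall j, measurable_fun setT (Y j)) -> (forall j t, `|Y j t| <= B)%R ->
  (forall j, \int[P]_t (Y j t)%:E = 0) ->
  P.-integrable setT (fun t => (a + \sum_j b j * Y j t)%:E) /\
  \int[P]_t (a + \sum_j b j * Y j t)%:E = a%:E.
Proof.
move=> mY YB Y0.
have iY j : P.-integrable setT (EFin \o Y j) by exact: bounded_integrable_prob.
have ibY j : P.-integrable setT (fun t => (b j)%:E * (Y j t)%:E).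
  by apply: integrableZl => //; exact: iY.
have ia : P.-integrable setT (fun=> a%:E).
  exact: (@bounded_integrable_prob (cst a) `|a|%R).
have isum : P.-integrable setT (fun t => \sum_j ((b j)%:E * (Y j t)%:E)).
  by apply: integrable_sum => // j _; exact: ibY.
under eq_fun do rewrite EFinD -sumEFin; split.
  exact: integrableD.
rewrite integralD// integral_sum// big1 ?adde0.
  by rewrite integral_cst//= probability_setT mule1.
by move=> j _; rewrite (integralZl measurableT (iY j) (b j)) Y0 mule0.
Qed.

End ProbabilityIntegrals.

Section NormMGFSum.
Context {R : realType} {d : measure_display} {T : measurableType d}.
Variable P : probability T R.
Context {I J : finType} (Z : I -> T -> R).
Hypothesis mZ : forall i, measurable_fun setT (Z i).
Hypothesis indepZ : mutually_independent P Z.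
Variables (zeta : R -> J -> R) (beta : R).
Hypothesis mzeta : forall j, measurable_fun setT (zeta ^~ j).
Hypotheses (beta0 : 0 <= beta) (beta2 : beta <= 2^-1).
Hypothesis zeta_le : forall x, sqn (zeta x) <= beta ^+ 2.

Local Open Scope ereal_scope.

Let zeta_beta x j : (`|zeta x j| <= beta)%R.
Proof.
rewrite -(@ler_pXn2r _ 2)// ?nnegrE// real_normK ?num_real//.
apply: le_trans (zeta_le x); rewrite /sqn (bigD1 j)//= lerDl.
by apply: sumr_ge0 => k _; exact: sqr_ge0.
Qed.

(** Integrating the newest summand with the others frozen removes the linear term of [expnorm_step];
    what remains is a factor [exp (beta^2 / 2) * (1 + 2 beta^2) <= exp (5/2 beta^2)] per summand.
    The leading 1 is [expnorm] at the zero vector. The size of [J] never enters, which later allows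
    [N] to be arbitrary. *)
Lemma integral_expnorm_sum (s : seq I) : uniq s ->
  (forall i j, i \in s -> \int[P]_t (zeta (Z i t) j)%:E = 0) ->
  \int[P]_t (expnorm (fun j => \sum_(i <- s) zeta (Z i t) j))%:E <=
  (expR (1 + 5 / 2 * beta ^+ 2 * (size s)%:R))%:E.
Proof.
elim: s => [_ _|i s IH /= /andP[iNs us] Z0].
  under eq_integral do under eq_fun do rewrite big_nil.
  rewrite integral_cst//= probability_setT mule1 /expnorm /sqn.
  by rewrite big1 ?addr0 ?sqrtr1 ?mulr0 ?addr0// => j _; rewrite expr0n.
have {}IH := IH us (fun k j ks => Z0 k j (mem_behead (s := i :: s) ks)).
pose S t j := (\sum_(k <- s) zeta (Z k t) j)%R.
pose F t u : \bar R := (expnorm (fun j => S t j + zeta (Z i u) j)%R)%:E.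
have mS j : measurable_fun [set: g_sigma_algebraType (cylinders Z [set k | k \in s])] (S ^~ j).
  apply: measurable_sum_seq => k ks; apply: (measurableT_comp (mzeta j)).
  by apply: measurable_cylinderfun; rewrite inE.
have mST j : measurable_fun setT (S ^~ j).
  by apply: measurable_sum_seq => k ks; exact: (measurableT_comp (mzeta j)).
have mzi j : measurable_fun setT (fun t => zeta (Z i t) j).
  exact: (measurableT_comp (mzeta j)).
have mSF : measurable_fun [set: (g_sigma_algebraType (cylinders Z [set k | k \in s]) *
    g_sigma_algebraType (cylinders Z [set i]))%type]
    (fun x => expnorm (fun j => S x.1 j + zeta (Z i x.2) j)%R).
  apply: measurable_expnorm => j; apply: measurable_funD.
    exact: (measurableT_comp (mS j) measurable_fst).
  apply: (measurableT_comp (mzeta j)).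
  apply: measurableT_comp measurable_snd.
  by apply: measurable_cylinderfun; rewrite inE.
under eq_integral do under eq_fun do rewrite big_cons addrC.
rewrite -/(F _ _).
rewrite (@integral_disjoint _ _ _ P _ Z mZ indepZ [set k | k \in s] [set i] F); last 3 first.
- by move=> k; rewrite !inE => /eqP->; exact/negbTE.
- by apply/measurable_EFinP; exact: mSF.
- by move=> t u; rewrite lee_fin expR_ge0.
apply: (@le_trans _ _ (\int[P]_t ((expR (5 / 2 * beta ^+ 2))%:E * (expnorm (S t))%:E))).
  apply: ge0_le_integral => //.
  - by move=> t _; apply: integral_ge0 => u _; rewrite lee_fin expR_ge0.
  - apply: (measurable_fun_fubini_tonelli_F (fun x => F x.1 x.2)) => /=.
      apply/measurable_EFinP; apply: measurable_expnorm => j; apply: measurable_funD.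
        exact: (measurableT_comp (mST j) measurable_fst).
      exact: (measurableT_comp (mzi j) measurable_snd).
    by move=> x; rewrite lee_fin expR_ge0.
  - by apply: measurable_funeM; apply/measurable_EFinP; exact: measurable_expnorm.
  - move=> t _; rewrite /F.
    pose C := (expnorm (S t) * expR (beta ^+ 2 / 2))%R.
    have C0 : (0 <= C)%R by rewrite mulr_ge0// expR_ge0.
    pose b j := (S t j / Num.sqrt (1 + sqn (S t)))%R.
    have mlin : measurable_fun setT
       (fun u => 1 + 2 * beta ^+ 2 + \sum_j b j * zeta (Z i u) j)%R.
      by apply: measurable_funD => //; apply: measurable_sum => j; exact: measurable_funM.
    apply: (@le_trans _ _ (\int[P]_u (C%:E *
       (1 + 2 * beta ^+ 2 + \sum_j b j * zeta (Z i u) j)%:E))).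
      apply: ge0_le_integral => //.
      - by move=> u _; rewrite lee_fin expR_ge0.
      - apply/measurable_EFinP/measurable_expnorm => j; exact: measurable_funD.
      - by apply: measurable_funeM; exact/measurable_EFinP.
      - by move=> u _; rewrite -EFinM lee_fin; exact: expnorm_step.
    have [ilin Elin] := @integral_affine_centred _ _ _ P _
      (fun j t => zeta (Z i t) j) beta (1 + 2 * beta ^+ 2)%R b mzi
      (fun j t => zeta_beta _ _) (fun j => Z0 i j (mem_head _ _)).
    rewrite integralZl// Elin -!EFinM lee_fin /C mulrAC [leRHS]mulrC.
    rewrite -mulrA ler_wpM2l ?expR_ge0//.
    have := expR_ge1Dx (2 * beta ^+ 2); move=> /ler_wpM2r => H.
    apply: le_trans (H _ (expR_ge0 (beta ^+ 2 / 2))) _.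
    by rewrite -expRD ler_expR; lra.
rewrite ge0_integralZl_EFin ?expR_ge0//; last 2 first.
- by move=> t _; rewrite lee_fin expR_ge0.
- by apply/measurable_EFinP; exact: measurable_expnorm.
apply: (@le_trans _ _ ((expR (5 / 2 * beta ^+ 2))%:E *
  (expR (1 + 5 / 2 * beta ^+ 2 * (size s)%:R))%:E)).
  by rewrite lee_wpmul2l// lee_fin expR_ge0.
by rewrite -EFinM -expRD lee_fin ler_expR -natr1; lra.
Qed.
End NormMGFSum.

(** * Gaussian quadratic exponential moments *)

Section GaussianIntegral.
Context {R : realType}.
Notation mu := (@lebesgue_measure R).
Local Open Scope ereal_scope.

(** The change of variables is available for the Radon-Nikodym derivative; it agrees almost
    everywhere with [normal_pdf] because both have the same integrals over measurable sets. *)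
Lemma integral_normal_prob (m s : R) (g : R -> \bar R) : s != 0%R ->
  measurable_fun setT g -> (forall x, 0 <= g x) ->
  \int[normal_prob m s]_x g x = \int[mu]_x (g x * (normal_pdf m s x)%:E).
Proof.
move=> s0 mg g0.
have dom := normal_prob_dominates m s.
have ipdf := integrable_normal_pdf m s.
rewrite -(Radon_Nikodym_SigmaFinite.change_of_variables dom)//.
apply: ae_eq_integral => //.
- apply: emeasurable_funM => //.
  exact: measurable_int (Radon_Nikodym_SigmaFinite.f_integrable dom).
- apply: emeasurable_funM => //; exact: measurable_int ipdf.
- apply: ae_eqe_mul2l; apply: integral_ae_eq => //.
  + exact: Radon_Nikodym_SigmaFinite.f_integrable.
  + exact: measurable_int ipdf.
  + by move=> A _ mA; rewrite -Radon_Nikodym_SigmaFinite.f_integral.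
Qed.

(** Completing the square turns the integrand into a constant times the density of the normal law
    with mean [b / (1 - a)] and variance [1 / (1 - a)]. *)
Lemma integral_expR_quadratic_normal (a b : R) : (0 <= a)%R -> (a < 1)%R ->
  \int[normal_prob 0 1]_x (expR (a * x ^+ 2 / 2 + b * x))%:E =
  ((Num.sqrt (1 - a))^-1 * expR (b ^+ 2 / (2 * (1 - a))))%:E.
Proof.
move=> a0 a1.
have q0 : (0 < 1 - a)%R by rewrite subr_gt0.
have [qn rn] : (1 - a != 0)%R /\ (Num.sqrt (1 - a) != 0)%R.
  by rewrite !gt_eqF ?sqrtr_gt0.
have me : measurable_fun setT (fun x : R => expR (a * x ^+ 2 / 2 + b * x)).
  apply: measurableT_comp => //; apply: measurable_funD => //.
    apply: measurable_funM => //; apply: measurable_funM => //.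
rewrite integral_normal_prob ?oner_eq0//; last exact/measurable_EFinP.
pose s := ((Num.sqrt (1 - a))^-1)%R.
have s0 : s != 0%R by rewrite invr_eq0.
pose m := (b / (1 - a))%R.
have s2 : (s ^+ 2 = (1 - a)^-1)%R by rewrite exprVn sqr_sqrtr ?ltW.
transitivity (\int[mu]_x ((s * expR (b ^+ 2 / (2 * (1 - a))))%:E * (normal_pdf m s x)%:E)).
  apply: eq_integral => x _; rewrite -!EFinM; congr EFin.
  rewrite !normal_pdfE ?oner_eq0//.
  rewrite /normal_peak /normal_fun s2 expr1n.
  have -> : (Num.sqrt ((1 - a)^-1 * pi *+ 2) = s * Num.sqrt (1 * pi *+ 2))%R.
    by rewrite -mulrnAr sqrtrM ?invr_ge0 ?ltW// sqrtrV ?ltW// mul1r.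
  transitivity ((Num.sqrt (1 * pi *+ 2))^-1 *
    (expR (b ^+ 2 / (2 * (1 - a))) * expR (- (x - m) ^+ 2 / ((1 - a)^-1 *+ 2))))%R.
    rewrite [LHS]mulrCA -!expRD; congr (_ * expR _)%R.
    by rewrite /m; field.
  by rewrite (invfM s) [RHS]mulrACA -[RHS]mulrA -[in RHS]mulrA mulVKf.
rewrite ge0_integralZl//; last 3 first.
- by apply/measurable_EFinP; exact: measurable_normal_pdf.
- by move=> x _; rewrite lee_fin normal_pdf_ge0.
- by rewrite lee_fin mulr_ge0 ?expR_ge0// invr_ge0 sqrtr_ge0.
by rewrite integral_normal_pdf// mule1.
Qed.

End GaussianIntegral.

(** * Quadratic forms and rank-one updates of an inverse matrix *)

Section QuadraticForms.
Context {R : realType} {N : nat}.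
Implicit Types (A B : 'M[R]_N) (s t v y : 'rV[R]_N).

Definition bform A s t : R := (s *m A *m t^T) 0 0.
Definition dotv s t : R := (s *m t^T) 0 0.

Lemma dotvE s t : dotv s t = \sum_k s 0 k * t 0 k.
Proof. by rewrite /dotv mxE; apply: eq_bigr => k _; rewrite mxE. Qed.

Lemma bformE A s t : bform A s t = \sum_k (\sum_l s 0 l * A l k) * t 0 k.
Proof. by rewrite /bform mxE; apply: eq_bigr => k _; rewrite !mxE. Qed.

Lemma bform_dotv A s t : bform A s t = dotv (s *m A) t. Proof. by []. Qed.

Lemma dotvv_ge0 s : 0 <= dotv s s.
Proof. by rewrite dotvE; apply: sumr_ge0 => k _; rewrite -expr2 sqr_ge0. Qed.

Lemma dotvv_eq0 s : dotv s s = 0 -> s = 0.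
Proof.
rewrite dotvE => /eqP; rewrite psumr_eq0; last by move=> k _; rewrite -expr2 sqr_ge0.
move=> /allP H; apply/rowP => k; rewrite mxE.
by have /= := H k (mem_index_enum k); rewrite mulf_eq0 orbb => /eqP.
Qed.

Lemma dotv_cs s t : dotv s t ^+ 2 <= dotv s s * dotv t t.
Proof.
rewrite !dotvE; have := cauchy_schwarz_sum (s 0) (t 0).
by under [X in _ <= X * _]eq_bigr do rewrite expr2; under [X in _ <= _ * X]eq_bigr do rewrite expr2.
Qed.

Lemma bformC A s t : A^T = A -> bform A s t = bform A t s.
Proof.
move=> AT; rewrite /bform.
have -> : s *m A *m t^T = (t *m A *m s^T)^T by rewrite !trmx_mul trmxK AT mulmxA.
by rewrite mxE.
Qed.

Lemma dotvDl s t v : dotv (s + t) v = dotv s v + dotv t v.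
Proof. by rewrite /dotv mulmxDl mxE. Qed.

Lemma dotvZl (z : R) s v : dotv (z *: s) v = z * dotv s v.
Proof. by rewrite /dotv -scalemxAl mxE. Qed.

Lemma dotvDr s t v : dotv v (s + t) = dotv v s + dotv v t.
Proof. by rewrite /dotv linearD mulmxDr mxE. Qed.

Lemma dotvZr (z : R) s v : dotv v (z *: s) = z * dotv v s.
Proof. by rewrite /dotv linearZ/= -scalemxAr mxE. Qed.

Lemma dotvC s t : dotv s t = dotv t s.
Proof. by rewrite !dotvE; apply: eq_bigr => k _; rewrite mulrC. Qed.

Lemma bform_addZ A s v (z : R) : A^T = A ->
  bform A (s + z *: v) (s + z *: v) =
  bform A s s + (bform A v v * z ^+ 2 + 2 * bform A s v * z).
Proof.
move=> AT; rewrite bform_dotv mulmxDl -scalemxAl dotvDl !dotvDr !dotvZl !dotvZr.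
rewrite -!bform_dotv (bformC v s)//; ring.
Qed.

Lemma bform_sub_rank_one A v s : bform (A - v^T *m v) s s = bform A s s - dotv s v ^+ 2.
Proof.
rewrite /bform mulmxBr mulmxBl mxE [X in _ + X]mxE; congr (_ - _).
rewrite mulmxA -(mulmxA (s *m v^T)) [s *m v^T]mx11_scalar mul_scalar_mx mxE.
by rewrite expr2; congr (_ * _); exact: dotvC.
Qed.

Section RankOneUpdate.
Variables (A B : 'M[R]_N) (v : 'rV[R]_N) (beta : R).
Hypotheses (AT : A^T = A) (AB : A *m B = 1%:M) (beta0 : 0 < beta).
Hypothesis B_ge : forall y, beta * dotv y y + dotv y v ^+ 2 <= bform B y y.
Let a := bform A v v.

Let y := v *m A.

(** [B_ge] tested at [y = v A]: since [A] inverts [B], both [y v^T] and [y B y^T] equal [a].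
    Everything about [a] below follows from this inequality. *)
Let yB : beta * dotv y y + a ^+ 2 <= a.
Proof.
have := B_ge y; rewrite /bform -(mulmxA v) AB mulmx1 trmx_mul AT mulmxA.
by rewrite -/(bform A v v) -/a.
Qed.

Lemma rank_one_ge0 : 0 <= a.
Proof. have := mulr_ge0 (ltW beta0) (dotvv_ge0 y); have := sqr_ge0 a; have := yB; lra. Qed.

Lemma rank_one_lt1 : a < 1.
Proof.
have yy := mulr_ge0 (ltW beta0) (dotvv_ge0 y); have := yB; have a0 := rank_one_ge0.
have [//|a1] := ltP a 1 => H.
have : dotv y y = 0.
  apply/eqP; rewrite eq_le dotvv_ge0 andbT -(pmulr_rle0 _ beta0); nra.
move/dotvv_eq0 => y0; move: a1; rewrite /a bform_dotv -/y y0 /dotv mul0mx mxE.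
by rewrite ler10.
Qed.

(** The factor produced by one Gaussian integration is the square root of the left-hand side.
    Cauchy-Schwarz [a^2 <= |y|^2 |v|^2] combined with [yB] gives [beta a <= (1 - a) |v|^2], which is
    the claim rearranged. *)
Lemma rank_one_inv : (1 - a)^-1 <= 1 + dotv v v / beta.
Proof.
have a1 := rank_one_lt1; have a0 := rank_one_ge0; have H := yB.
have cs := dotv_cs y v; rewrite -bform_dotv -/a in cs.
have v0 := dotvv_ge0 v.
rewrite -div1r ler_pdivrMr ?subr_gt0//.
rewrite -(ler_pM2r beta0) mulrAC mulrDl mul1r divfK ?gt_eqF//.
have [a00|ap] := eqVneq a 0; first by rewrite a00 subr0 mulr1; lra.
have {}ap : 0 < a by rewrite lt_neqAle eq_sym ap.
have : a * (beta * a) <= a * ((1 - a) * dotv v v).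
  have : beta * a ^+ 2 <= beta * dotv y y * dotv v v by rewrite -mulrA ler_pM2l.
  have : beta * dotv y y * dotv v v <= (a - a ^+ 2) * dotv v v by rewrite ler_wpM2r//; lra.
  lra.
rewrite ler_pM2l//; lra.
Qed.

(** The Sherman-Morrison formula for the inverse of [B - v^T v]. *)
Definition rank_one_mx := A + (1 - a)^-1 *: (A *m v^T *m v *m A).

Lemma rank_one_sym : rank_one_mx^T = rank_one_mx.
Proof.
by rewrite /rank_one_mx linearD/= linearZ/= !trmx_mul trmxK AT !mulmxA.
Qed.

Lemma rank_one_mul : rank_one_mx *m (B - v^T *m v) = 1%:M.
Proof.
have a1 : 1 - a != 0 by rewrite gt_eqF// subr_gt0 rank_one_lt1.
rewrite /rank_one_mx mulmxBr !mulmxDl AB -!scalemxAl -(mulmxA _ A B) AB mulmx1.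
have aE : v *m A *m v^T = a%:M by rewrite [LHS]mx11_scalar.
have -> : A *m v^T *m v *m A *m (v^T *m v) = a *: (A *m v^T *m v).
  rewrite -!mulmxA (mulmxA A v^T) (mulmxA v) (mulmxA (v *m A)) aE.
  by rewrite mul_scalar_mx -scalemxAr !mulmxA.
rewrite scalerA mulmxA; set W := A *m v^T *m v.
have -> : W + ((1 - a)^-1 * a) *: W = (1 - a)^-1 *: W.
  by rewrite -{1}[W]scale1r -scalerDl; congr (_ *: _); field.
by rewrite addrK.
Qed.

Lemma rank_one_bform s : bform rank_one_mx s s = bform A s s + bform A s v ^+ 2 / (1 - a).
Proof.
rewrite bform_dotv /rank_one_mx mulmxDr -scalemxAr dotvDl dotvZl -bform_dotv.
congr (_ + _); rewrite mulrC expr2 {2}(bformC s v)//; congr (_ * _).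
rewrite /dotv !mulmxA -!(mulmxA (s *m A *m v^T)) [s *m A *m v^T]mx11_scalar.
by rewrite mul_scalar_mx mxE.
Qed.

End RankOneUpdate.
End QuadraticForms.

Section Law.
Context {R : realType} d (T : measurableType d) (P : probability T R).
Local Open Scope ereal_scope.

Lemma integral_law d' (T' : measurableType d') (X : T -> T')
    (nu : {measure set T' -> \bar R}) (g : T' -> \bar R) :
  measurable_fun setT X ->
  (forall A, measurable A -> P (X @^-1` A) = nu A) ->
  measurable_fun setT g -> (forall x, 0 <= g x) ->
  \int[P]_t g (X t) = \int[nu]_x g x.
Proof.
move=> mX lawX mg g0.
pose X' : {mfun T >-> T'} := mfun_Sub (mem_set mX).
transitivity (\int[distribution P X']_x g x).
  by rewrite ge0_integral_distribution.
by apply: eq_measure_integral => A mA _; exact: lawX.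
Qed.

End Law.

Section GaussianQuadraticMGF.
Context {R : realType} {d : measure_display} {T : measurableType d}.
Variable P : probability T R.
Context {I : finType} {N : nat} (Z : I -> T -> R) (v : I -> 'rV[R]_N).
Hypothesis mZ : forall i, measurable_fun setT (Z i).
Hypothesis indepZ : mutually_independent P Z.

Definition wsum (s : seq I) t : 'rV[R]_N := \sum_(i <- s) Z i t *: v i.

Lemma wsumE s t k : wsum s t 0 k = \sum_(i <- s) Z i t * v i 0 k.
Proof. by rewrite summxE; apply: eq_bigr => i _; rewrite mxE. Qed.

Lemma measurable_bform d' (T' : measurableType d') (A : 'M[R]_N) (f g : T' -> 'rV[R]_N) :
  (forall k, measurable_fun setT (fun t => f t 0 k)) ->
  (forall k, measurable_fun setT (fun t => g t 0 k)) ->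
  measurable_fun setT (fun t => bform A (f t) (g t)).
Proof.
move=> mf mg; under eq_fun do rewrite bformE.
apply: measurable_sum => k; apply: measurable_funM => //.
by apply: measurable_sum => l; apply: measurable_funM.
Qed.

Local Open Scope ereal_scope.

Lemma integral_expR_bform (s : seq I) : uniq s ->
  (forall i, i \in s -> forall A, measurable A ->
     P (Z i @^-1` A) = normal_prob 0 1 A) ->
  forall (A B : 'M[R]_N) (beta : R), A^T = A -> A *m B = 1%:M -> (0 < beta)%R ->
  (forall y, beta * dotv y y + \sum_(i <- s) dotv y (v i) ^+ 2 <= bform B y y)%R ->
  \int[P]_t (expR (bform A (wsum s t) (wsum s t) / 2))%:E <=
  (expR ((\sum_(i <- s) dotv (v i) (v i)) / (2 * beta)))%:E.
Proof.
elim: s => [_ _ A B beta _ _ _ _|i s IH /= /andP[iNs us] lawZ A B beta AT AB beta0 B_ge].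
  rewrite /wsum; under eq_integral do rewrite big_nil /bform !mul0mx mxE mul0r expR0.
  by rewrite integral_cst//= probability_setT mule1 big_nil mul0r expR0.
have B_ge' y : (beta * dotv y y + dotv y (v i) ^+ 2 <= bform B y y)%R.
  apply: le_trans (B_ge y); rewrite big_cons lerD2l lerDl.
  by apply: sumr_ge0 => j _; exact: sqr_ge0.
pose a := bform A (v i) (v i).
have a0 : (0 <= a)%R := rank_one_ge0 AT AB beta0 B_ge'.
have a1 : (a < 1)%R := rank_one_lt1 AT AB beta0 B_ge'.
have ainv := rank_one_inv AT AB beta0 B_ge'; rewrite -/a in ainv.
have {}IH := IH us (fun j js => lawZ j (mem_behead (s := i :: s) js))
  (rank_one_mx A (v i)) (B - (v i)^T *m v i)%R beta
  (rank_one_sym _ AT) (rank_one_mul AT AB beta0 B_ge') beta0.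
have {}IH := IH _.
pose F t u : \bar R := (expR (bform A (wsum s t + Z i u *: v i)
  (wsum s t + Z i u *: v i) / 2))%:E.
have mS k : measurable_fun [set: g_sigma_algebraType (cylinders Z [set k | k \in s])]
    (fun t => (wsum s t 0 k)%R).
  rewrite (funext (fun t => wsumE s t k)).
  apply: measurable_sum_seq => j js; apply: measurable_funM => //.
  by apply: measurable_cylinderfun; rewrite inE.
have mST k : measurable_fun setT (fun t => (wsum s t 0 k)%R).
  rewrite (funext (fun t => wsumE s t k)).
  by apply: measurable_sum => j; apply: measurable_funM.
have mF d1 d2 (T1 : measurableType d1) (T2 : measurableType d2)
    (W : T1 -> 'rV[R]_N) (z : T2 -> R) :
  (forall k, measurable_fun setT (fun t => (W t 0 k)%R)) ->
  measurable_fun setT z ->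
  measurable_fun [set: (T1 * T2)%type]
   (fun x => expR (bform A (W x.1 + z x.2 *: v i) (W x.1 + z x.2 *: v i) / 2)).
  move=> mW mz; apply: measurableT_comp => //; apply: measurable_funM => //.
  have mk k : measurable_fun [set: (T1 * T2)%type] (fun x => (W x.1 + z x.2 *: v i) 0 k)%R.
    under eq_fun do rewrite mxE [X in (_ + X)%R]mxE.
    apply: measurable_funD; first exact: (measurableT_comp (mW k) measurable_fst).
    by apply: measurable_funM => //; exact: (measurableT_comp mz measurable_snd).
  exact: measurable_bform.
have -> : \int[P]_t (expR (bform A (wsum (i :: s) t) (wsum (i :: s) t) / 2))%:E =
    \int[P]_t F t t.
  by apply: eq_integral => t _; rewrite /F /wsum big_cons addrC.
rewrite (@integral_disjoint _ _ _ P _ Z mZ indepZ [set k | k \in s] [set i] F); last 3 first.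
- by move=> k; rewrite !inE => /eqP->; exact/negbTE.
- apply/measurable_EFinP; apply: mF => //.
  by apply: measurable_cylinderfun; rewrite inE.
- by move=> t u; rewrite lee_fin expR_ge0.
have innerE t : \int[P]_u F t u =
    (expR (bform (rank_one_mx A (v i)) (wsum s t) (wsum s t) / 2) * (Num.sqrt (1 - a))^-1)%:E.
  pose b := bform A (wsum s t) (v i).
  have -> : \int[P]_u F t u = \int[P]_u ((expR (bform A (wsum s t) (wsum s t) / 2))%:E *
       (expR (a * Z i u ^+ 2 / 2 + b * Z i u))%:E).
    apply: eq_integral => u _; rewrite /F bform_addZ// -EFinM -expRD.
    by congr (expR _)%:E; rewrite -/a -/b; field.
  have mg : measurable_fun setT (fun x : R => (expR (a * x ^+ 2 / 2 + b * x))%:E).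
    apply/measurable_EFinP; apply: measurableT_comp => //; apply: measurable_funD => //.
    by apply: measurable_funM => //; apply: measurable_funM.
  rewrite ge0_integralZl_EFin ?expR_ge0//; last exact: measurableT_comp mg (mZ i).
  have -> := @integral_law _ _ _ P _ (measurableTypeR R) (Z i) (normal_prob 0 1) _ (mZ i)
    (lawZ i (mem_head _ _)) mg (fun x => expR_ge0 (a * x ^+ 2 / 2 + b * x)).
  rewrite integral_expR_quadratic_normal// -EFinM; congr EFin.
  rewrite (rank_one_bform (v i) AT) -/a -/b.
  have -> : ((bform A (wsum s t) (wsum s t) + b ^+ 2 / (1 - a)) / 2 =
     bform A (wsum s t) (wsum s t) / 2 + b ^+ 2 / (2 * (1 - a)))%R.
    by field; rewrite subr_eq0 eq_sym lt_eqF.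
  by rewrite expRD -mulrA [(_^-1 * _)%R]mulrC.
under eq_integral do rewrite innerE EFinM.
rewrite ge0_integralZr ?lee_fin ?invr_ge0 ?sqrtr_ge0//; last first.
  apply/measurable_EFinP; apply: measurableT_comp => //; apply: measurable_funM => //.
  exact: measurable_bform.
apply: (@le_trans _ _ ((expR ((\sum_(i <- s) dotv (v i) (v i)) / (2 * beta)))%:E *
  (expR (dotv (v i) (v i) / (2 * beta)))%:E)).
  apply: lee_pmul.
  - by apply: integral_ge0 => t _; rewrite lee_fin expR_ge0.
  - by rewrite lee_fin invr_ge0 sqrtr_ge0.
  - apply: IH => y.
    have := B_ge y; rewrite big_cons bform_sub_rank_one; lra.
  - rewrite lee_fin -(@ler_pXn2r _ 2)// ?nnegrE ?expR_ge0 ?invr_ge0 ?sqrtr_ge0//.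
    rewrite exprVn sqr_sqrtr; last by rewrite subr_ge0 ltW.
    rewrite -expRM_natl; apply: (le_trans ainv); apply: le_trans (expR_ge1Dx _) _.
    rewrite ler_expR le_eqVlt; apply/orP; left; apply/eqP; field.
    by rewrite gt_eqF.
by rewrite -EFinM -expRD lee_fin ler_expR big_cons [leRHS]mulrDl [leRHS]addrC.
Qed.
End GaussianQuadraticMGF.

(** * The Sobolev space and its inner product *)

Section IntegralAE.
Context {R : realType} d (T : measurableType d) (mu : {measure set T -> \bar R}).
Local Open Scope ereal_scope.
Import HBNNSimple.

Let nnint (f : T -> \bar R) := ereal_sup [set sintegral mu h |
  h in [set h : {nnsfun T >-> R} | forall x, (h x)%:E <= f x]].

Let nnint_le (f g : T -> \bar R) (N : set T) : measurable N -> mu N = 0 ->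
  (forall x, 0 <= g x) -> (forall x, ~ N x -> f x = g x) -> nnint f <= nnint g.
Proof.
move=> mN N0 g0 fg; apply: ge_ereal_sup => _ [h hf <-].
pose h' : {nnsfun T >-> R} := mul_nnsfun h (indic_nnsfun R (measurableC mN)).
have -> : sintegral mu h = sintegral mu h'.
  rewrite -!integralT_nnsfun; apply: ae_eq_integral => //.
  - exact/measurable_EFinP.
  - exact/measurable_EFinP.
  - exists N; split => // x /=; apply: contra_notP => Nx _.
    by rewrite /= /mindic indicE mem_set//= mulr1.
apply: ereal_sup_ubound; exists h' => // x /=; rewrite /mindic indicE.
have [xN|xN] := pselect (N x).
  by rewrite memNset ?mulr0//=; apply: contra_notP.
by rewrite mem_set// mulr1 -fg.
Qed.

(* No measurability is needed: the integral of a nonnegative function is a supremum over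
   simple functions below it, and these can be killed on a null set.  This matters because
   [Dm] need not be Borel measurable. *)
Lemma ae_eq_integral_nomeas (D : set T) (f g : T -> \bar R) :
  {ae mu, forall x, D x -> f x = g x} ->
  \int[mu]_(x in D) f x = \int[mu]_(x in D) g x.
Proof.
move=> [N [mN N0 fgN]].
have fg x : ~ N x -> (f \_ D) x = (g \_ D) x.
  move=> xN; rewrite !patchE; case: ifPn => //; rewrite inE => Dx.
  by apply: contra_notP xN => fgx; apply: fgN => /= /(_ Dx).
rewrite /integral -!/(nnint _); congr (_ - _); apply/eqP; rewrite eq_le; apply/andP; split;
  apply: (nnint_le mN N0) => // x xN; by rewrite ?funeposE ?funenegE fg.
Qed.

Lemma ae_eq_Rintegral_nomeas (D : set T) (f g : T -> R) :
  {ae mu, forall x, D x -> f x = g x} ->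
  (\int[mu]_(x in D) f x = \int[mu]_(x in D) g x)%R.
Proof.
move=> fg; congr fine; apply: ae_eq_integral_nomeas.
by apply: filterS fg => x fgx Dx; rewrite fgx.
Qed.

End IntegralAE.

Section AbsoluteContinuity.
Context {R : realType}.
Implicit Types (f g : R -> R) (x y a b : R).
Notation mu := (@lebesgue_measure R).

Lemma abs_cont01_dist f : abs_cont01 f -> forall e, 0 < e ->
  exists2 del, 0 < del & forall x y, x \in `[0, 1] -> y \in `[0, 1] ->
    `|x - y| < del -> `|f x - f y| < e.
Proof.
move=> fac e e0; have [del del0 H] := fac e e0; exists del => // x y x01 y01.
wlog xy : x y x01 y01 / x <= y.
  move=> W; have [xy|/ltW yx] := leP x y; first exact: W.
  by rewrite distrC [X in _ -> X < _]distrC; exact: W.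
rewrite distrC ger0_norm ?subr_ge0// => yx.
have := H 1%N (fun=> x) (fun=> y); rewrite !big_ord1 distrC; apply => //.
- move=> i _; move: x01 y01; rewrite !in_itv/= => /andP[? ?] /andP[? ?].
  by split.
- by move=> i j ij j1; move: ij; rewrite ltnS leqn0 in j1; rewrite (eqP j1).
Qed.

Lemma abs_cont01_continuous f : abs_cont01 f -> {within `[0, 1], continuous f}.
Proof.
move=> fac; apply/subspace_continuousP => x x01.
apply/cvgrPdist_lt => e e0; have [del del0 H] := abs_cont01_dist fac e0.
have Hn : \forall y \near x, `|x - y| < del by exact: (@nbhsx_ballx _ _ x del del0).
near=> y; apply: H => //.
  near: y; exact: withinT.
near: y; rewrite near_withinE; apply: filterS Hn => y xy _; exact: xy.
Unshelve. all: end_near. Qed.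

Lemma abs_cont01_lin f g a b : abs_cont01 f -> abs_cont01 g ->
  abs_cont01 (fun x => a * f x + b * g x).
Proof.
move=> fac gac e e0.
pose C := `|a| + `|b| + 1.
have C0 : 0 < C by rewrite /C; have := normr_ge0 a; have := normr_ge0 b; lra.
have eC : 0 < e / C by rewrite divr_gt0.
have [d1 d10 H1] := fac _ eC; have [d2 d20 H2] := gac _ eC.
exists (Num.min d1 d2) => [|k p q pq qp]; first by rewrite lt_min d10.
rewrite lt_min => /andP[/(H1 _ _ _ pq qp) Hf /(H2 _ _ _ pq qp) Hg].
apply: (@le_lt_trans _ _ (`|a| * \sum_(i < k) `|f (q i) - f (p i)|
   + `|b| * \sum_(i < k) `|g (q i) - g (p i)|)).
  rewrite !mulr_sumr -big_split/=; apply: ler_sum => i _.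
  rewrite -!normrM; apply: le_trans (ler_normD _ _).
  by rewrite le_eqVlt; apply/orP; left; apply/eqP; congr `|_|; ring.
apply: (@le_lt_trans _ _ (`|a| * (e / C) + `|b| * (e / C))).
  by apply: lerD; rewrite ler_wpM2l// ltW.
have -> : `|a| * (e / C) + `|b| * (e / C) = e - e / C.
  by rewrite -mulrDl /C; field; rewrite gt_eqF.
lra.
Qed.

Lemma abs_cont01_affine a b : abs_cont01 (fun x => a + b * x).
Proof.
move=> e e0; exists (e / (`|b| + 1)).
  by rewrite divr_gt0// ltr_wpDl.
move=> k p q pq _; rewrite ltr_pdivlMr ?ltr_wpDl// => H.
apply: le_lt_trans H; rewrite mulr_suml; apply: ler_sum => i _.
have [_ [pqi _]] := pq i (ltn_ord i).
have -> : a + b * q i - (a + b * p i) = (q i - p i) * b by ring.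
rewrite normrM ger0_norm ?subr_ge0// ler_wpM2l ?subr_ge0//.
by rewrite lerDl.
Qed.

(** A nonzero value would persist on an open interval, which has positive measure. *)
Lemma ae_zero_continuous f : {within `[0, 1], continuous f} ->
  {ae mu, forall x, x \in `]0, 1[ -> f x = 0} ->
  forall x, x \in `]0, 1[ -> f x = 0.
Proof.
move=> fc [N [mN N0 HN]] x x01; apply/eqP/negPn/negP => fx0.
have fcx : {for x, continuous f}.
  by have [/(_ x x01)] := (continuous_within_itvP f ltr01).1 fc.
have /nbhs_ex[e He] : \forall y \near x, f y != 0 /\ y \in `]0, 1[.
  near=> y; split; near: y.
    exact: (fcx _ (open_nbhs_nbhs (conj (@open_neq _ 0) fx0))).
  exact: near_in_itvoo.
have sub : `]x - e%:num, x + e%:num[ `<=` N.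
  move=> y /= ye; apply: HN => /= fy0.
  have [|fy y01] := He y; first by rewrite ball_itv.
  by rewrite fy0// eqxx in fy.
pose I : set R := `]x - e%:num, x + e%:num[%classic.
have : (mu I <= mu N)%E.
  apply: le_measure => //; rewrite inE//.
  exact: measurable_itv.
have e0 : 0 < e%:num by [].
rewrite N0 /I lebesgue_measure_itv/= lte_fin ltrD2l gtrN// -EFinB lee_fin.
lra.
Unshelve. all: end_near. Qed.

End AbsoluteContinuity.

(** * Borel representatives of the top derivative *)

Section SobolevTop.
Context {R : realType}.
Implicit Types (f g D E : R -> R) (d e : nat -> R -> R) (m : nat).
Notation mu := (@lebesgue_measure R).

Lemma ae_imp2 (P Q S : R -> Prop) : (forall x, P x -> Q x -> S x) ->
  {ae mu, forall x, P x} -> {ae mu, forall x, Q x} -> {ae mu, forall x, S x}.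
Proof. exact: (filterS2 (ae_filter_ringOfSetsType mu)). Qed.

Lemma ae_imp (P Q : R -> Prop) : (forall x, P x -> Q x) ->
  {ae mu, forall x, P x} -> {ae mu, forall x, Q x}.
Proof. by move=> PQ HP; apply: (ae_imp2 _ HP HP) => x Px _; exact: PQ. Qed.

Lemma abs_cont01_measurable f : abs_cont01 f -> measurable_fun (`[0, 1]%classic : set R) f.
Proof.
move=> fac; apply: subspace_continuous_measurable_fun => //.
exact: abs_cont01_continuous.
Qed.

Lemma ae_in_itv_cc (Q : R -> Prop) :
  {ae mu, forall x, x \in `]0, 1[ -> Q x} -> {ae mu, forall x, x \in `[0, 1] -> Q x}.
Proof.
move=> [N [mN N0 HN]]; have n01 a : mu.-negligible [set a].
  by exists [set a]; split => //; exact: lebesgue_measure_set1.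
have nN : mu.-negligible N by exists N; split.
apply: negligibleS (negligibleU nN (negligibleU (n01 0) (n01 1))) => x /= nQ.
have [->|x0] := eqVneq x 0; first by right; left.
have [->|x1] := eqVneq x 1; first by right; right.
left; apply: HN => /= xQ; apply: nQ => x01; apply: xQ.
by move: x01; rewrite !in_itv/= !lt_neqAle eq_sym x0 x1.
Qed.

(** A witness prescribes [d m] only almost everywhere, so [d m] itself may fail to be Borel. Off the
    exceptional null set it is a limit of difference quotients of the continuous function
    [d (m - 1)], which gives a measurable representative. *)
Lemma measurable_top_derivative m f d : (1 <= m)%N -> sob_witness m f d ->
  exists D, measurable_fun setT D /\ {ae mu, forall x, x \in `[0, 1] -> d m x = D x}.
Proof.
case: m => // m _ [_ dac dder _]; pose g := d m.
have [N [mN N0 HN]] := dder m (ltnSn m).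
pose E := (`]0, 1[%classic : set R) `\` N.
have mE : measurable E by exact: measurableD.
exists (d m.+1 \_ E); split; last first.
  apply: ae_in_itv_cc; exists N; split => // x /=.
  apply: contra_notP => xN x01; rewrite patchE mem_set//.
apply/(measurable_restrictT _ mE).
(* Extending by zero makes the quotients measurable on the whole line; at a given [x < 1] they
   coincide with those of [g] as soon as the increment is below [1 - x]. *)
pose gt := g \_ (`[0, 1]%classic : set R).
have mg : measurable_fun setT gt.
  by apply/(measurable_restrictT g) => //; exact: abs_cont01_measurable (dac m (ltnSn m)).
apply: (@measurable_fun_cvg _ (measurableTypeR R) R E
  (fun k (x : R) => k.+1%:R * (gt (k.+1%:R^-1 + x) - gt x))).
  move=> k.
  apply: (@measurable_funTS _ _ _ _ E (fun x => k.+1%:R * (gt (k.+1%:R^-1 + x) - gt x))).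
  apply: measurable_funM => //.
  have ms : measurable_fun setT (fun x : R => k.+1%:R^-1 + x) by exact: measurable_funD.
  exact: measurable_funB (measurableT_comp mg ms) mg.
move=> x [x01 xN].
have [dg <-] : derivable g x 1 /\ derive1 g x = d m.+1 x.
  have : (x \in `]0, 1[ -> derivable (d m) x 1 /\ derive1 (d m) x = d m.+1 x).
    by apply: contra_notP xN => ?; exact: HN.
  exact.
have cg : h^-1 *: (g (h + x) - g x) @[h --> 0^'] --> derive1 g x.
  move: dg; rewrite /derivable /derive1.
  by under eq_fun do rewrite /= /GRing.scale/= mulr1.
have := (cvgr_dnbhsP _ _ _).1 cg harmonic.
have h0 : (forall n, @harmonic R n != 0) /\ @harmonic R n @[n --> \oo] --> (0 : R).
  by split; [move=> n; rewrite invr_eq0 pnatr_eq0|exact: cvg_harmonic].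
move=> /(_ h0); apply: cvg_trans; apply: near_eq_cvg.
have x1 : 0 < 1 - x by move: x01; rewrite /= in_itv/= => /andP[? ?]; lra.
near=> k; rewrite /= invrK /GRing.scale/=; congr (_ * _).
move: x01; rewrite /= in_itv/= => /andP[x0 _].
have kx : k.+1%:R^-1 < 1 - x.
  near: k; exact: (cvgr_lt _ (@cvg_harmonic R)).
have k0 : 0 < k.+1%:R^-1 :> R by rewrite invr_gt0.
move: (k.+1%:R^-1) k0 kx => q q0 qx.
by rewrite /gt !patchE !mem_set//= in_itv/=; apply/andP; split; lra.
Unshelve. all: end_near. Qed.

(** [Dm] selects a witness by choice, so [Jf] is meaningful only if the choice is immaterial.
    Equality of [d j] and [e j] on the open interval gives almost everywhere equality one order
    higher, and below order [m] continuity upgrades it to equality everywhere. *)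
Lemma sob_witness_unique m f d e : (1 <= m)%N ->
  sob_witness m f d -> sob_witness m f e ->
  {ae mu, forall x, x \in `[0, 1] -> d m x = e m x}.
Proof.
move=> m1 [d0 dac dder _] [e0 eac eder _].
have step j : (j < m)%N -> (forall x, x \in `]0, 1[ -> d j x = e j x) ->
    {ae mu, forall x, x \in `]0, 1[ -> d j.+1 x = e j.+1 x}.
  move=> jm dej; apply: (ae_imp2 _ (dder j jm) (eder j jm)) => x dx ex x01.
  have [[_ <-] [_ <-]] := (dx x01, ex x01).
  rewrite !derive1E; apply: near_eq_derive.
  by near=> y; apply: dej; near: y; exact: near_in_itvoo.
have eq_lt j : (j < m)%N -> forall x, x \in `]0, 1[ -> d j x = e j x.
  elim: j => [_ x x01|j IH jm].
    by rewrite d0 ?e0//; exact: subset_itv_oo_cc.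
  have jm' := ltnW jm.
  have H := @ae_zero_continuous R (fun x => 1 * d j.+1 x + (- 1) * e j.+1 x)
     (abs_cont01_continuous (abs_cont01_lin 1 (- 1) (dac _ jm) (eac _ jm))).
  move=> x /H; rewrite mul1r mulN1r => /(_ _)/eqP; rewrite subr_eq0 => /(_ _)/eqP; apply.
  apply: (ae_imp _ (step j jm' (IH jm'))) => y dey y01.
  by rewrite dey// mul1r mulN1r subrr.
apply: ae_in_itv_cc; rewrite -(prednK m1).
by apply: step; rewrite ?prednK//; apply: eq_lt; rewrite prednK.
Unshelve. all: end_near. Qed.

(** A Borel [m]-th derivative. Unlike [Dm], it can be added and scaled, so linearity of [Jf] is
    proved through it. *)
Definition is_top m f D := exists d,
  [/\ sob_witness m f d, d m = D & measurable_fun setT D].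

Lemma Sobolev_top m f : (1 <= m)%N -> Sobolev m f -> exists D, is_top m f D.
Proof.
move=> m1 [d dw]; have [D [mD dD]] := measurable_top_derivative m1 dw.
have [d0 dac dder dint] := dw.
exists D, (fun j => if j == m then D else d j); split => //; last by rewrite eqxx.
split => //.
- by move=> x x01; case: eqP m1 => [<-//|_ _]; exact: d0.
- by move=> j jm; rewrite ltn_eqF//; exact: dac.
- move=> j jm; rewrite (ltn_eqF jm); have := dder j jm.
  case: eqP => [j1m|//] H.
  apply: (ae_imp2 _ H dD) => x Hx Dx x01; have [? ->] := Hx x01; split => //.
  by rewrite j1m Dx//; exact: subset_itv_oo_cc.
- rewrite eqxx.
  have mD2 : measurable_fun setT (fun x => ((D x) ^+ 2)%:E).
    by apply/measurable_EFinP; exact: measurable_funX.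
  apply/integrableP; split; first exact: measurable_funTS.
  have /integrableP[_] := dint; apply: le_lt_trans.
  rewrite le_eqVlt; apply/orP; left; apply/eqP.
  apply: ae_eq_integral_nomeas; apply: (ae_imp _ dD) => x Dx x01.
  by rewrite Dx.
Qed.

Lemma is_top_Sobolev m f D : is_top m f D -> Sobolev m f.
Proof. by move=> [d [dw _ _]]; exists d. Qed.

Lemma is_top_int m f D : is_top m f D -> mu.-integrable `[0, 1] (fun x => (D x ^+ 2)%:E).
Proof. by move=> [d [[_ _ _ dint] <- _]]. Qed.

Lemma is_top_meas m f D : is_top m f D -> measurable_fun setT D.
Proof. by move=> [d []]. Qed.

Lemma is_top_lin m f g D E a b : is_top m f D -> is_top m g E ->
  is_top m (fun x => a * f x + b * g x) (fun x => a * D x + b * E x).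
Proof.
move=> fD gE; have mD := is_top_meas fD; have mE := is_top_meas gE.
have iD := is_top_int fD; have iE := is_top_int gE.
move: fD gE => [d [[d0 dac dder dint] dD _]] [e [[e0 eac eder eint] eE _]].
have mDE : measurable_fun setT (fun x => a * D x + b * E x).
  by apply: measurable_funD; exact: measurable_funM.
exists (fun j x => a * d j x + b * e j x); split; last exact: mDE; last by rewrite dD eE.
split.
- by move=> x x01; rewrite d0// e0.
- by move=> j jm; apply: abs_cont01_lin; [exact: dac|exact: eac].
- move=> j jm; apply: (ae_imp2 _ (dder j jm) (eder j jm)) => x dx ex x01.
  have [[dd <-] [de <-]] := (dx x01, ex x01).
  have H : is_derive x 1 (a \*: d j + b \*: e j) (a *: 'D_1 (d j) x + b *: 'D_1 (e j) x).
    by apply: is_deriveD; apply: is_deriveZ; exact: derivableP.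
  split; first exact: (@ex_derive _ _ _ _ _ _ _ H).
  by rewrite !derive1E; exact: (@derive_val _ _ _ _ _ _ _ H).
- rewrite dD eE; apply: (@le_integrable _ (measurableTypeR R) R mu _ _ _
    (fun x : R => (2 * a ^+ 2)%:E * (D x ^+ 2)%:E + (2 * b ^+ 2)%:E * (E x ^+ 2)%:E)%E) => //.
  + by apply/measurable_EFinP; apply: measurable_funTS; exact: measurable_funX.
  + move=> x _; rewrite -!EFinM -EFinD !abse_EFin lee_fin.
    rewrite ger0_norm ?sqr_ge0// (le_trans _ (ler_norm _))//.
    have := sqr_ge0 (a * D x - b * E x); nra.
  + by apply: integrableD => //; apply: integrableZl.
Qed.

Lemma Dm_top m f D : (1 <= m)%N -> is_top m f D ->
  {ae mu, forall x, x \in `[0, 1] -> Dm m f x = D x}.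
Proof.
move=> m1 [d [dw <- _]]; rewrite /Dm; case: pselect => [fS|[]]; last by exists d.
by case: cid => e ew /=; exact: sob_witness_unique ew dw.
Qed.

Lemma Jf_top m f g D E : (1 <= m)%N -> is_top m f D -> is_top m g E ->
  Jf m f g = Rintegral mu `[0, 1] (fun x => D x * E x).
Proof.
move=> m1 fD gE; apply: ae_eq_Rintegral_nomeas.
apply: (ae_imp2 _ (Dm_top m1 fD) (Dm_top m1 gE)) => x fx gx x01.
by rewrite fx ?gx.
Qed.

End SobolevTop.

Lemma lebesgue_measure01 {R : realType} :
  @lebesgue_measure R (`[0, 1]%classic : set R) = 1%E.
Proof. by rewrite lebesgue_measure_itv/= lte_fin ltr01 -EFinB subr0. Qed.

Section SquareIntegrable.
Context {R : realType}.
Implicit Types (f g k D E : R -> R) (a b : R).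
Notation mu := (@lebesgue_measure R).
Notation I01 := (`[0, 1]%classic : set R).

Definition L2 f := measurable_fun I01 f /\ mu.-integrable I01 (fun x => (f x ^+ 2)%:E).

Lemma L2_mul f g : L2 f -> L2 g -> mu.-integrable I01 (EFin \o (fun x => f x * g x)).
Proof.
move=> [mf if2] [mg ig2].
apply: (@le_integrable _ (measurableTypeR R) R mu _ _ _
    (fun x : R => (f x ^+ 2)%:E + (g x ^+ 2)%:E)%E) => //.
- by apply/measurable_EFinP; exact: measurable_funM.
- move=> x _; rewrite -EFinD [(EFin \o _) x]/= !abse_EFin lee_fin (le_trans _ (ler_norm _))// normrM.
  have := sqr_ge0 (`|f x| - `|g x|).
  rewrite -(real_normK (num_real (f x))) -(real_normK (num_real (g x))).
  have := normr_ge0 (f x); have := normr_ge0 (g x); nra.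
- exact: integrableD.
Qed.

Lemma VfC f g : Vf f g = Vf g f.
Proof. by apply: eq_Rintegral => x _; rewrite mulrC. Qed.

Lemma Vf_lin f g k a b : L2 f -> L2 g -> L2 k ->
  Vf (fun x => a * f x + b * g x) k = a * Vf f k + b * Vf g k.
Proof.
move=> fL gL kL; have fk := L2_mul fL kL; have gk := L2_mul gL kL.
rewrite /Vf -!RintegralZl// -RintegralD//; last 2 first.
- exact: (@integrableZl _ (measurableTypeR R) R mu _ _ a (EFin \o (fun x => f x * k x))).
- exact: (@integrableZl _ (measurableTypeR R) R mu _ _ b (EFin \o (fun x => g x * k x))).
by apply: eq_Rintegral => x _; ring.
Qed.

Lemma Vf_ge0 f : 0 <= Vf f f.
Proof. by apply: Rintegral_ge0 => x _; rewrite -expr2 sqr_ge0. Qed.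

End SquareIntegrable.

Section SobolevInner.
Context {R : realType}.
Variables (m : nat) (m1 : (1 <= m)%N).
Implicit Types (f g k D E : R -> R) (a b lam : R).
Notation mu := (@lebesgue_measure R).
Notation I01 := (`[0, 1]%classic : set R).

Lemma Sobolev_continuous f : Sobolev m f -> {within I01, continuous f}.
Proof.
move=> [d [d0 dac _ _]].
apply: (@subspace_eq_continuous _ _ _ (d 0%N)).
  by move=> x; rewrite inE => x01; exact: d0.
exact: (abs_cont01_continuous (dac _ m1)).
Qed.

Lemma Sobolev_L2 f : Sobolev m f -> L2 f.
Proof.
move=> fS; have fc := Sobolev_continuous fS.
split; first by apply: subspace_continuous_measurable_fun.
apply: (@continuous_compact_integrable R (fun x => f x ^+ 2)); first exact: segment_compact.
have -> : (fun x => f x ^+ 2) = f \* f by apply/funext => x /=; rewrite expr2.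
by move=> x; apply: continuousM; exact: fc.
Qed.

Lemma is_top_L2 f D : is_top m f D -> L2 D.
Proof.
move=> fD; split; last exact: is_top_int fD.
exact: measurable_funTS (is_top_meas fD).
Qed.

Lemma Sobolev_lin f g a b : Sobolev m f -> Sobolev m g ->
  Sobolev m (fun x => a * f x + b * g x).
Proof.
move=> /(Sobolev_top m1)[D fD] /(Sobolev_top m1)[E gE].
exact: is_top_Sobolev (is_top_lin a b fD gE).
Qed.

Lemma JfC f g : Jf m f g = Jf m g f.
Proof. by apply: eq_Rintegral => x _; rewrite mulrC. Qed.

Lemma Jf_lin f g k a b : Sobolev m f -> Sobolev m g -> Sobolev m k ->
  Jf m (fun x => a * f x + b * g x) k = a * Jf m f k + b * Jf m g k.
Proof.
move=> /(Sobolev_top m1)[D fD] /(Sobolev_top m1)[E gE] /(Sobolev_top m1)[F kF].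
rewrite (Jf_top m1 (is_top_lin a b fD gE) kF) (Jf_top m1 fD kF) (Jf_top m1 gE kF).
exact: Vf_lin (is_top_L2 fD) (is_top_L2 gE) (is_top_L2 kF).
Qed.

Lemma Jf_ge0 f : 0 <= Jf m f f.
Proof. exact: Vf_ge0. Qed.

Lemma Jf_cs f g : Sobolev m f -> Sobolev m g -> Jf m f g ^+ 2 <= Jf m f f * Jf m g g.
Proof.
move=> fS gS; apply: discriminant_le => [|t]; first exact: Jf_ge0.
have := Jf_ge0 (fun x => t * f x + 1 * g x).
have tS := Sobolev_lin t 1 fS gS.
by rewrite Jf_lin// JfC (JfC g) !Jf_lin// (JfC g f) => H; apply: le_trans H _; lra.
Qed.

Section Inner.
Variables (lam : R) (lam0 : 0 <= lam).
Notation ip := (inner m lam).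

Lemma innerC f g : ip f g = ip g f.
Proof. by rewrite /inner VfC JfC. Qed.

Lemma inner_lin f g k a b : Sobolev m f -> Sobolev m g -> Sobolev m k ->
  ip (fun x => a * f x + b * g x) k = a * ip f k + b * ip g k.
Proof.
move=> fS gS kS; rewrite /inner Jf_lin// Vf_lin//; do ?exact: Sobolev_L2.
ring.
Qed.

Lemma inner_ge0 f : 0 <= ip f f.
Proof. by rewrite /inner addr_ge0 ?Vf_ge0 ?mulr_ge0 ?Jf_ge0. Qed.

Lemma inner_sqr f g t : Sobolev m f -> Sobolev m g ->
  ip (fun x => t * f x + 1 * g x) (fun x => t * f x + 1 * g x) =
  ip f f * t ^+ 2 + 2 * ip f g * t + ip g g.
Proof.
move=> fS gS; have tS := Sobolev_lin t 1 fS gS.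
by rewrite inner_lin// innerC (innerC g) !inner_lin// (innerC g f); ring.
Qed.

Lemma inner_cs f g : Sobolev m f -> Sobolev m g -> ip f g ^+ 2 <= ip f f * ip g g.
Proof.
move=> fS gS; apply: discriminant_le => [|t]; first exact: inner_ge0.
by rewrite -inner_sqr// inner_ge0.
Qed.

Lemma snorm_ge0 f : 0 <= snorm m lam f. Proof. exact: sqrtr_ge0. Qed.

Lemma snorm_sqr f : snorm m lam f ^+ 2 = ip f f.
Proof. by rewrite sqr_sqrtr// inner_ge0. Qed.

End Inner.

(** Supplies the test functions for the lower bounds on [kap2]. The inequality covers both [m = 1],
    where the energy is [b ^ 2], and [m >= 2], where it vanishes. *)
Lemma Sobolev_affine a b : Sobolev m (fun x => a + b * x) /\
  Jf m (fun x => a + b * x) (fun x => a + b * x) <= b ^+ 2.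
Proof.
pose d j : R -> R := match j with
  | O => fun x => a + b * x | S O => fun=> b | _ => fun=> 0 end.
have H : is_top m (fun x => a + b * x) (d m).
  exists d; split => //; last first.
    case: (m) => [|[|k]]; rewrite /d; [|exact: measurable_cst..].
    by apply: measurable_funD => //; exact: measurable_funM.
  split => //.
  - case=> [_|[|j] _] /=; first exact: abs_cont01_affine.
      have := abs_cont01_affine b 0; congr abs_cont01.
      by apply/funext => x; rewrite mul0r addr0.
    have := @abs_cont01_affine R 0 0; congr abs_cont01.
    by apply/funext => x; rewrite mul0r addr0.
  - case=> [_|[|j] _] /=; apply: (@aeW _ (measurableTypeR R)) => x _.
    + have H : is_derive x 1 (cst a + b \*: (id : R -> R)) (0 + b *: (1 : R)).
        by apply: is_deriveD; apply: is_deriveZ.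
      split; first exact: (@ex_derive _ _ _ _ _ _ _ H).
      rewrite derive1E; have := @derive_val _ _ _ _ _ _ _ H.
      by rewrite add0r /GRing.scale/= mulr1.
    + by split; [exact: derivable_cst|exact: derive1_cst].
    + by split; [exact: derivable_cst|exact: derive1_cst].
  - apply: (@continuous_compact_integrable R (fun x => d m x ^+ 2)); first exact: segment_compact.
    apply: continuous_subspaceT.
    case: (m) m1 => [//|[|k] _] /= x; exact: cst_continuous.
split; first exact: is_top_Sobolev H.
rewrite (Jf_top m1 H H).
apply: (@le_trans _ _ (Rintegral mu I01 (fun=> b ^+ 2))); last first.
  by rewrite Rintegral_cst// [X in fine X]lebesgue_measure01 /= mulr1.
apply: le_Rintegral => //.
- exact: (L2_mul (is_top_L2 H) (is_top_L2 H)).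
- apply: (@continuous_compact_integrable R (fun=> b ^+ 2)); first exact: segment_compact.
  by apply: continuous_subspaceT => x; exact: cst_continuous.
- move=> x _; case: (m) m1 => [//|[|k] _] /=; first by rewrite expr2.
  by rewrite mulr0 sqr_ge0.
Qed.

End SobolevInner.

(** * Orthonormal expansions and the reproducing kernel *)

Section Expansion.
Context {R : realType}.
Variables (m : nat) (m1 : (1 <= m)%N) (lam : R) (lam0 : 0 < lam).
Implicit Types (f g k : R -> R) (a b : R) (c : nat -> R) (psi : nat -> R -> R).
Notation mu := (@lebesgue_measure R).
Notation ip := (inner m lam).
Let lamW : 0 <= lam. Proof. exact: ltW. Qed.

Definition lincomb c psi N : R -> R := fun x => \sum_(nu < N) c nu * psi nu x.

Lemma lincombS c psi N : lincomb c psi N.+1 =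
  fun x => 1 * lincomb c psi N x + c N * psi N x.
Proof. by apply/funext => x; rewrite /lincomb big_ord_recr/= mul1r. Qed.

Lemma Sobolev0 : Sobolev m (fun _ : R => 0).
Proof.
have [+ _] := @Sobolev_affine R m m1 0 0; congr Sobolev.
by apply/funext => x; rewrite mul0r addr0.
Qed.

Lemma lincomb0 c psi : lincomb c psi 0 = fun=> 0.
Proof. by apply/funext => x; rewrite /lincomb big_ord0. Qed.

Lemma Sobolev_lincomb c psi N : (forall nu, Sobolev m (psi nu)) ->
  Sobolev m (lincomb c psi N).
Proof.
move=> pS; elim: N => [|N IH]; first by rewrite lincomb0; exact: Sobolev0.
by rewrite lincombS; exact: Sobolev_lin.
Qed.

Lemma bilinear_lincomb (B : (R -> R) -> (R -> R) -> R) c psi N k :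
  (forall f g k a b, Sobolev m f -> Sobolev m g -> Sobolev m k ->
    B (fun x => a * f x + b * g x) k = a * B f k + b * B g k) ->
  (forall nu, Sobolev m (psi nu)) -> Sobolev m k ->
  B (lincomb c psi N) k = \sum_(nu < N) c nu * B (psi nu) k.
Proof.
move=> Blin pS kS; elim: N => [|N IH].
  pose z (_ : R) : R := 0; rewrite lincomb0 big_ord0 -/z.
  transitivity (B (fun x => 0 * z x + 0 * z x) k).
    by congr B; apply/funext => x; rewrite mul0r addr0.
  by rewrite Blin ?mul0r ?addr0//; exact: Sobolev0.
rewrite lincombS Blin//; last exact: Sobolev_lincomb.
by rewrite IH mul1r big_ord_recr.
Qed.

Lemma Vf_lin_Sobolev f g k a b : Sobolev m f -> Sobolev m g -> Sobolev m k ->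
  Vf (fun x => a * f x + b * g x) k = a * Vf f k + b * Vf g k.
Proof. by move=> fS gS kS; rewrite Vf_lin//; exact: (Sobolev_L2 m1). Qed.

Lemma Vf_le_inner f : Vf f f <= ip f f.
Proof. by rewrite /inner lerDl mulr_ge0 ?Jf_ge0. Qed.

Lemma Jf_le_inner f : lam * Jf m f f <= ip f f.
Proof. by rewrite /inner lerDr Vf_ge0. Qed.

Definition rest c psi N g : R -> R := g \- lincomb c psi N.

Lemma restE c psi N g : rest c psi N g = fun x => (- 1) * lincomb c psi N x + 1 * g x.
Proof. by apply/funext => x; rewrite /rest /= mulN1r mul1r addrC. Qed.

Lemma Sobolev_rest c psi N g : (forall nu, Sobolev m (psi nu)) -> Sobolev m g ->
  Sobolev m (rest c psi N g).
Proof. by move=> pS gS; rewrite restE; apply: Sobolev_lin => //; exact: Sobolev_lincomb. Qed.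

Lemma sum_inv_sqr_le N : \sum_(nu < N) (nu.+1%:R ^- 2 : R) <= 2.
Proof.
case: N => [|N]; first by rewrite big_ord0.
suff: \sum_(nu < N.+1) (nu.+1%:R ^- 2 : R) <= 2 - N.+1%:R^-1.
  by move/le_trans; apply; rewrite gerBl invr_ge0.
elim: N => [|N IH]; first by rewrite big_ord1 expr1n invr1; lra.
rewrite big_ord_recr/=; apply: le_trans (lerD IH (lexx _)) _.
have p1 : 0 < N.+1%:R :> R by rewrite ltr0n.
rewrite -[N.+2%:R]natr1; set p : R := N.+1%:R in p1 *.
have -> : 2 - p^-1 + (p + 1) ^- 2 = 2 - (p + 1)^-1 - (p * (p + 1) ^+ 2)^-1.
  by field; rewrite ?gt_eqF//; lra.
by rewrite gerBl invr_ge0 mulr_ge0 ?sqr_ge0// ltW.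
Qed.

Lemma eq0_cvg0 (a : R) (u : nat -> R) (C : R) N0 :
  (forall N, (N0 <= N)%N -> `|a| <= C * u N) -> u @ \oo --> (0 : R) -> a = 0.
Proof.
move=> H uc; apply/eqP; rewrite -normr_le0.
have cc : C * u N @[N --> \oo] --> C * 0 by apply: cvgM => //; exact: cvg_cst.
rewrite mulr0 in cc.
have -> : 0 = lim (C * u N @[N --> \oo]) by apply/esym/cvg_lim.
apply: limr_ge; first by apply/cvg_ex; exists 0.
by near=> N; apply: H; near: N; exact: nbhs_infty_ge.
Unshelve. all: end_near. Qed.

Lemma sum_lt_leq N0 N : (\sum_(nu < N) (nu < N0)%N <= N0)%N.
Proof.
suff -> : (\sum_(nu < N) (nu < N0)%N = minn N N0)%N by exact: geq_minr.
elim: N => [|N IH]; first by rewrite big_ord0 min0n.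
rewrite big_ord_recr/= IH; case: (ltnP N N0); lia.
Qed.

(* [psi nu = phi nu / sqrt (1 + lam rho nu)] is an orthonormal basis for [inner]. *)
Lemma orthonormal_basis : A1 m lam -> exists psi : nat -> R -> R,
  [/\ (forall nu, Sobolev m (psi nu)),
      (forall i j, ip (psi i) (psi j) = (i == j)%:R),
      (forall i j, i != j -> Vf (psi i) (psi j) = 0),
      (forall g, Sobolev m g ->
        snorm m lam (rest (fun nu => ip g (psi nu)) psi N g) @[N --> \oo] --> (0 : R)) &
      exists C : R, forall N x, x \in `[0, 1] -> \sum_(nu < N) psi nu x ^+ 2 <= C].
Proof.
move=> [phi [rho [crho [c0 [pS [[B Bphi] [rhon [rhoc [Vphi [Jphi expand]]]]]]]]]].
pose w nu := 1 + lam * rho nu.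
have wE i j : ip (phi i) (phi j) = w i * (i == j)%:R.
  by rewrite /inner Vphi Jphi /w mulrDl mul1r mulrA.
have w1 nu : 1 <= w nu.
  have := Vf_le_inner (phi nu); rewrite wE Vphi eqxx/= mulr1; exact.
have w0 nu : 0 < w nu by apply: lt_le_trans (w1 nu).
have sw0 nu : 0 < Num.sqrt (w nu) by rewrite sqrtr_gt0.
have sw nu : Num.sqrt (w nu) * Num.sqrt (w nu) = w nu by rewrite -expr2 sqr_sqrtr// ltW.
(* The null second term gives [psi nu] the two-term shape of [Sobolev_lin] and [inner_lin]. *)
pose psi nu x := (Num.sqrt (w nu))^-1 * phi nu x + 0 * phi nu x.
have psiE nu x : psi nu x = (Num.sqrt (w nu))^-1 * phi nu x by rewrite /psi mul0r addr0.
have psiS nu : Sobolev m (psi nu) by exact: Sobolev_lin.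
have ippsi nu k : Sobolev m k -> ip (psi nu) k = (Num.sqrt (w nu))^-1 * ip (phi nu) k.
  by move=> kS; rewrite inner_lin// mul0r addr0.
have Vfpsi nu k : Sobolev m k -> Vf (psi nu) k = (Num.sqrt (w nu))^-1 * Vf (phi nu) k.
  by move=> kS; rewrite Vf_lin_Sobolev// mul0r addr0.
(* A1 expands with [V]-coefficients. For [N > nu] the inner product of the remainder with [phi nu]
   is exactly this difference, and it tends to 0 by Cauchy-Schwarz. *)
have coef g nu : Sobolev m g -> ip g (phi nu) = w nu * Vf g (phi nu).
  move=> gS; apply/eqP; rewrite -subr_eq0; apply/eqP.
  apply: (@eq0_cvg0 _ _ (snorm m lam (phi nu)) nu.+1 _ (expand g gS)) => N nuN.
  pose c i := Vf g (phi i).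
  have rS : Sobolev m (rest c phi N g) by exact: Sobolev_rest.
  rewrite -/(lincomb c phi N) -/(rest c phi N g).
  have -> : ip g (phi nu) - w nu * Vf g (phi nu) = ip (rest c phi N g) (phi nu).
    rewrite restE inner_lin//; last exact: Sobolev_lincomb.
    rewrite (bilinear_lincomb _ _ (@inner_lin _ _ m1 lam))//.
    rewrite (bigD1 (Ordinal nuN))//= wE eqxx mulr1 big1 ?addr0; first by rewrite /c; ring.
    by move=> i inu; rewrite wE (_ : (_ == _) = false) ?mulr0//; apply/negbTE.
  rewrite -(@ler_pXn2r _ 2)// ?nnegrE ?mulr_ge0 ?snorm_ge0//.
  by rewrite real_normK ?num_real// exprMn !snorm_sqr// mulrC; exact: inner_cs.
exists psi; split => //.
- move=> i j; rewrite ippsi// innerC ippsi// innerC wE.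
  case: eqP => [->|_]; last by rewrite !mulr0.
  by rewrite mulr1 mulrA -invfM sw mulVf// gt_eqF.
- by move=> i j ij; rewrite Vfpsi// VfC Vfpsi// VfC Vphi (negbTE ij) !mulr0.
- move=> g gS; rewrite (_ : (fun N => _) = (fun N => snorm m lam
    (g \- (fun x => \sum_(nu < N) Vf g (phi nu) * phi nu x)))); first exact: expand.
  apply/funext => N; congr snorm; apply/funext => x; rewrite /rest /lincomb /=; congr (_ - _).
  apply: eq_bigr => nu _; rewrite innerC ippsi// innerC coef// psiE.
  by move: (Num.sqrt (w nu)) (sw nu) (sw0 nu) => q <- q0; field; exact: lt0r_neq0.
(* Boundedness of the [phi nu] reduces the claim to summability of [1 / w nu]. Beyond [N0], [rho nu]
   exceeds half of its asymptotic value, which is at least of order [nu ^ 2] since [m >= 1]; the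
   first [N0] terms are at most 1 each. *)
- have crho2 : 0 < crho ^+ (2 * m) by rewrite exprn_gt0.
  have [N0 _ HN0] : \forall N \near \oo, 2^-1 < rho N / (crho * N.+1%:R) ^+ (2 * m).
    by apply: (cvgr_gt _ rhoc); lra.
  pose A := 2 / (lam * crho ^+ (2 * m)).
  have A0 : 0 < A by rewrite divr_gt0 ?mulr_gt0.
  have winv nu : (w nu)^-1 <= (nu < N0)%N%:R + A * nu.+1%:R ^- 2.
    have [nuN|Nnu] := ltnP nu N0.
      apply: (@le_trans _ _ 1); first by rewrite invf_le1.
      by rewrite lerDl mulr_ge0 ?invr_ge0 ?exprn_ge0// ltW.
    rewrite add0r -[leRHS]invrK lef_pV2 ?posrE//; last first.
      by rewrite invr_gt0 mulr_gt0// invr_gt0 exprn_gt0// ltr0n.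
    have := HN0 nu Nnu; rewrite /= ltr_pdivlMr ?exprn_gt0 ?mulr_gt0 ?ltr0n// exprMn => H.
    apply: (@le_trans _ _ (lam * rho nu)); last by rewrite /w lerDr.
    have p0 : 0 < nu.+1%:R :> R by rewrite ltr0n.
    have -> : (A * nu.+1%:R ^- 2)^-1 = lam * crho ^+ (2 * m) * nu.+1%:R ^+ 2 / 2.
      by rewrite /A; field; rewrite !lt0r_neq0.
    have : nu.+1%:R ^+ 2 <= nu.+1%:R ^+ (2 * m) :> R.
      by rewrite ler_weXn2l ?ler1n// leq_pmulr.
    rewrite -(ler_pM2l crho2) -(ler_pM2l lam0) => H2.
    move: H; rewrite -(ltr_pM2l lam0) => H.
    lra.
  exists (B ^+ 2 * (N0%:R + A * 2)) => N x x01.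
  apply: (@le_trans _ _ (\sum_(nu < N) B ^+ 2 * ((nu < N0)%N%:R + A * nu.+1%:R ^- 2))).
    apply: ler_sum => nu _; rewrite psiE exprMn exprVn sqr_sqrtr ?(ltW (w0 _))// mulrC.
    apply: ler_pM; rewrite ?sqr_ge0 ?invr_ge0 ?(ltW (w0 _))//.
    have := Bphi nu x x01 => H; rewrite -real_normK ?num_real// ler_pXn2r// nnegrE//.
    exact: le_trans H.
  rewrite -mulr_sumr ler_wpM2l ?sqr_ge0// big_split/= lerD//; last first.
    by rewrite -mulr_sumr ler_wpM2l ?(ltW A0)// sum_inv_sqr_le.
  rewrite -natr_sum ler_nat.
  exact: sum_lt_leq.
Qed.

End Expansion.

Section Limits.
Context {R : realType}.

Lemma le0_cvg0 (a : R) (u : nat -> R) (C : R) :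
  (forall N, a <= C * u N) -> u @ \oo --> (0 : R) -> a <= 0.
Proof.
move=> H uc.
have cc : C * u N @[N --> \oo] --> C * 0 by apply: cvgM => //; exact: cvg_cst.
rewrite mulr0 in cc.
have -> : 0 = lim (C * u N @[N --> \oo]) by apply/esym/cvg_lim.
apply: limr_ge; first by apply/cvg_ex; exists 0.
by near=> N; exact: H.
Unshelve. all: end_near. Qed.

Lemma ler_sqr_ge0 (a b : R) : 0 <= b -> a ^+ 2 <= b ^+ 2 -> a <= b.
Proof.
move=> b0 H; apply: le_trans (ler_norm a) _.
by rewrite -(@ler_pXn2r _ 2)// ?nnegrE// real_normK ?num_real.
Qed.

(** Divide by [t] and let [t] tend to 0; the witness is small enough that [t q <= - p / 2]. *)
Lemma affine_ge0 (p q : R) : (forall t, 0 < t -> 0 <= t * p + t ^+ 2 * q) -> 0 <= p.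
Proof.
move=> H; rewrite leNgt; apply/negP => p0.
pose t := - p / (2 * (`|q| + 1)).
have q0 : 0 < `|q| + 1 by rewrite ltr_wpDl.
have t0 : 0 < t by rewrite divr_gt0 ?mulr_gt0 ?oppr_gt0.
have := H t t0; rewrite expr2 -mulrA -mulrDr pmulr_rge0//.
have : t * q <= t * (`|q| + 1).
  by rewrite ler_pM2l//; have := ler_norm q; lra.
have -> : t * (`|q| + 1) = - p / 2 by rewrite /t; field; exact: lt0r_neq0.
lra.
Qed.

End Limits.

Section AffineIntegral.
Context {R : realType}.
Notation mu := (@lebesgue_measure R).

Lemma Vf_affine (a b : R) : Vf (fun x => a + b * x) (fun x => a + b * x) =
  a ^+ 2 + a * b + b ^+ 2 / 3.
Proof.
pose p : {poly R} := (a ^+ 2)%:P * 'X + (a * b)%:P * 'X^2 + (b ^+ 2 / 3)%:P * 'X^3.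
have cF : continuous (fun x => p.[x]) by exact: continuous_horner.
have dF x : is_derive x (1 : R) (fun x => p.[x]) (deriv p).[x] by exact: is_derive_poly.
rewrite /Vf /Rintegral.
have p'E x : (deriv p).[x] = (a + b * x) * (a + b * x).
  rewrite /p !poly.derivE !hornerE /=.
  by field.
have cF' (A : set R) : {within A, continuous (fun x : R => (a + b * x) * (a + b * x))}.
  have -> : (fun x : R => (a + b * x) * (a + b * x)) = (fun x => (deriv p).[x]).
    by apply/funext => ?; rewrite p'E.
  by apply: continuous_subspaceT; exact: continuous_horner.
rewrite (@continuous_FTC2 _ _ (fun x => p.[x]) 0 1)//.
- by rewrite -EFinB /p !hornerE/=; field.
- split.
  + by move=> x _; exact: (@ex_derive _ _ _ _ _ _ _ (dF x)).
  + exact: cvg_at_right_filter (cF 0).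
  + exact: cvg_at_left_filter (cF 1).
- move=> x _; rewrite derive1E -p'E; exact: (@derive_val _ _ _ _ _ _ _ (dF x)).
Qed.
End AffineIntegral.

(** * Pointwise bounds from the kernel, in an orthonormal basis *)

Section RKHS.
Context {R : realType}.
Variables (m : nat) (m1 : (1 <= m)%N) (h : R) (h0 : 0 < h) (K : R -> R -> R).
Implicit Types (f g k : R -> R).
Notation mu := (@lebesgue_measure R).
Notation lam := (h ^+ (2 * m)).
Notation ip := (inner m lam).
Hypothesis hK : reproducing_kernel m lam K.
Variable psi : nat -> R -> R.
Hypothesis psiS : forall nu, Sobolev m (psi nu).
Hypothesis psi_orth : forall i j, ip (psi i) (psi j) = (i == j)%:R.
Hypothesis psi_V : forall i j, i != j -> Vf (psi i) (psi j) = 0.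
Hypothesis psi_exp : forall g, Sobolev m g ->
  snorm m lam (rest (fun nu => ip g (psi nu)) psi N g) @[N --> \oo] --> (0 : R).
Hypothesis psi_bnd : exists C : R, forall N x, x \in `[0, 1] -> \sum_(nu < N) psi nu x ^+ 2 <= C.

Let lam0 : 0 < lam. Proof. by rewrite exprn_gt0. Qed.
Let lamW : 0 <= lam. Proof. exact: ltW. Qed.

Notation coef g := (fun nu => ip g (psi nu)).
Notation proj g N := (lincomb (coef g) psi N).
Notation rst g N := (rest (coef g) psi N g).

Lemma eval_kernel g x : Sobolev m g -> x \in `[0, 1] -> g x ^+ 2 <= K x x * ip g g.
Proof.
move=> gS x01; have [KS Kr] := hK x01.
by rewrite -{1}(Kr g gS) -(Kr (K x) KS); exact: inner_cs.
Qed.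

Lemma split_proj g N x : g x = proj g N x + rst g N x.
Proof. by rewrite /rest /= addrC subrK. Qed.

(** Needed for the supremum in [cK] to be a genuine upper bound: [sup] of an unbounded set is a
    default value. The coefficients of [K x] are [psi nu x], so its partial sums at [x] are the sums
    bounded by [psi_bnd], and the remainder at [x] vanishes in the limit by [eval_kernel]. *)
Lemma kernel_bounded : exists C : R, forall x, x \in `[0, 1] -> K x x <= C.
Proof.
have [C HC] := psi_bnd; exists C => x x01; have [KS Kr] := hK x01.
have K0 : 0 <= K x x by rewrite -(Kr _ KS) inner_ge0.
rewrite -subr_le0; apply: (le0_cvg0 (C := Num.sqrt (K x x)) _ (psi_exp KS)) => N.
have := split_proj (K x) N x => E.
have := HC N x x01; rewrite (_ : \sum_(nu < N) _ = proj (K x) N x); last first.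
  by apply: eq_bigr => nu _; rewrite (Kr _ (psiS nu)) expr2.
have rS : Sobolev m (rst (K x) N) by exact: Sobolev_rest.
have : rst (K x) N x <= Num.sqrt (K x x) * snorm m lam (rst (K x) N).
  apply: ler_sqr_ge0; first by rewrite mulr_ge0 ?sqrtr_ge0 ?snorm_ge0.
  by rewrite exprMn sqr_sqrtr// snorm_sqr//; exact: eval_kernel.
move: E; lra.
Qed.

Lemma kernel_le_cK x : x \in `[0, 1] -> K x x <= cK h K ^+ 2 / h.
Proof.
move=> x01; have [C HC] := kernel_bounded.
have [KS Kr] := hK x01.
have K0 : 0 <= K x x by rewrite -(Kr _ KS) inner_ge0.
rewrite ler_pdivlMr// mulrC -[leLHS]sqr_sqrtr ?mulr_ge0 ?(ltW h0)//.
have H : Num.sqrt (h * K x x) <= cK h K.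
  apply: ub_le_sup; last by exists x.
  exists (Num.sqrt (h * C)) => _ [y y01 <-].
  by apply: ler_wsqrtr; rewrite ler_pM2l//; exact: HC.
by rewrite ler_pXn2r// nnegrE ?sqrtr_ge0//; apply: le_trans H; exact: sqrtr_ge0.
Qed.

Notation kap2 := (cK h K ^+ 2 / h).

Lemma kap2_ge0 : 0 <= kap2.
Proof. by rewrite divr_ge0 ?sqr_ge0// ltW. Qed.

Lemma eval_le g x : Sobolev m g -> x \in `[0, 1] -> g x ^+ 2 <= kap2 * ip g g.
Proof.
move=> gS x01; apply: le_trans (eval_kernel gS x01) _.
by rewrite ler_wpM2r ?inner_ge0//; exact: kernel_le_cK.
Qed.

Lemma inner_lincomb (c : nat -> R) N : ip (lincomb c psi N) (lincomb c psi N) =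
  \sum_(nu < N) c nu ^+ 2.
Proof.
have lS := Sobolev_lincomb m1 c N psiS.
rewrite (bilinear_lincomb m1 c N (@inner_lin _ _ m1 lam))//.
apply: eq_bigr => nu _; rewrite innerC (bilinear_lincomb m1 c N (@inner_lin _ _ m1 lam))//.
rewrite (bigD1 nu)//= psi_orth eqxx mulr1 big1 ?addr0 ?expr2// => i inu.
by rewrite psi_orth (_ : (_ == _) = false) ?mulr0//; exact/negbTE.
Qed.

(** Apply [eval_le] to the combination with coefficients [psi nu x]: its value at [x] and its
    squared norm are the same number [s], so [s^2 <= kap2 s]. *)
Lemma sum_psi_le N x : x \in `[0, 1] -> \sum_(nu < N) psi nu x ^+ 2 <= kap2.
Proof.
move=> x01; set s := \sum_(nu < N) _.
have s0 : 0 <= s by apply: sumr_ge0 => nu _; exact: sqr_ge0.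
have := eval_le (Sobolev_lincomb m1 (psi^~ x) N psiS) x01.
rewrite inner_lincomb -/s (_ : lincomb _ _ _ x = s); last first.
  by apply: eq_bigr => nu _; rewrite expr2.
have [->|sn] := eqVneq s 0; first by rewrite kap2_ge0.
by rewrite expr2 ler_pM2r// lt_neqAle eq_sym sn.
Qed.

Lemma bessel g N : Sobolev m g ->
  ip g g = \sum_(nu < N) ip g (psi nu) ^+ 2 + ip (rst g N) (rst g N).
Proof.
move=> gS; have pS := Sobolev_lincomb m1 (coef g) N psiS.
have E : ip (proj g N) g = \sum_(nu < N) ip g (psi nu) ^+ 2.
  rewrite (bilinear_lincomb m1 _ N (@inner_lin _ _ m1 lam))//.
  by apply: eq_bigr => nu _; rewrite [ip (psi _) g]innerC expr2.
by rewrite restE inner_sqr// inner_lincomb E; ring.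
Qed.

Lemma sum_Vf_le N : \sum_(nu < N) Vf (psi nu) (psi nu) <= kap2.
Proof.
have pL nu := Sobolev_L2 m1 (psiS nu).
have [iS ES] : mu.-integrable `[0, 1] (EFin \o (fun x => \sum_(nu < N) psi nu x ^+ 2)) /\
    Rintegral mu `[0, 1] (fun x => \sum_(nu < N) psi nu x ^+ 2) =
    \sum_(nu < N) Vf (psi nu) (psi nu).
  elim: N => [|N [iS ES]].
    rewrite big_ord0 (_ : (fun x => _) = fun=> 0); last by apply/funext => x; rewrite big_ord0.
    split; first exact: integrable0.
    by rewrite Rintegral_cst// mul0r.
  rewrite big_ord_recr/= -ES.
  have -> : (fun x => \sum_(nu < N.+1) psi nu x ^+ 2) =
      (fun x => \sum_(nu < N) psi nu x ^+ 2 + psi N x * psi N x).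
    by apply/funext => x; rewrite big_ord_recr/= expr2.
  have iN := L2_mul (pL N) (pL N).
  split; last by rewrite RintegralD.
  exact: (@integrableD _ (measurableTypeR R) R mu _ _ _ _ iS iN).
rewrite -ES.
have -> : kap2 = Rintegral mu `[0, 1] (fun=> kap2).
  by rewrite Rintegral_cst// [X in fine X]lebesgue_measure01 mulr1.
apply: le_Rintegral => //.
- apply: (@continuous_compact_integrable R (fun=> kap2)); first exact: segment_compact.
  by apply: continuous_subspaceT => x; exact: cst_continuous.
- by move=> x x01; apply: sum_psi_le.
Qed.

Lemma kap2_ge1 : 1 <= kap2.
Proof.
have [gS gJ] := @Sobolev_affine R m m1 1 0.
have one01 : (1 : R) \in `[0, 1] by rewrite in_itv/= ler01 lexx.
have := eval_le gS one01.
rewrite /inner Vf_affine.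
have : lam * Jf m (fun x => 1 + 0 * x) (fun x => 1 + 0 * x) <= lam * 0 ^+ 2 by rewrite ler_pM2l.
rewrite expr0n/= !mulr0 mul0r !addr0 expr1n => /(ler_wpM2l kap2_ge0).
lra.
Qed.

(** In L2, [6 x - 2] represents evaluation at 1 on affine functions, so it is the natural test
    function. Its value at 1 and its squared L2 norm are both 4, whence [16 <= kap2 (4 + 36 lam)];
    the threshold [1 / 27] is where [3 (4 + 36 lam) = 16]. *)
Lemma kap2_ge3 : 3 <= kap2 \/ 1 / 27 <= lam.
Proof.
have [gS gJ] := @Sobolev_affine R m m1 (- 2) 6.
have one01 : (1 : R) \in `[0, 1] by rewrite in_itv/= ler01 lexx.
have := eval_le gS one01.
rewrite /inner Vf_affine.
have : lam * Jf m (fun x => - 2 + 6 * x) (fun x => - 2 + 6 * x) <= lam * 6 ^+ 2 by rewrite ler_pM2l.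
move=> /(ler_wpM2l kap2_ge0) H1 H2.
have [|k3] := leP 3 kap2; first by left.
right; rewrite leNgt; apply/negP => l27.
have : kap2 * (4 + lam * 36) < 3 * (4 + 36 / 27).
  have := kap2_ge0; nra.
lra.
Qed.

Lemma coef_le g N : Sobolev m g -> \sum_(nu < N) ip g (psi nu) ^+ 2 <= ip g g.
Proof. by move=> gS; rewrite (bessel N gS) lerDl inner_ge0. Qed.

Lemma rest_le g N : Sobolev m g -> snorm m lam (rst g N) <= snorm m lam g.
Proof.
move=> gS; apply: ler_wsqrtr; rewrite (bessel N gS) lerDr.
by apply: sumr_ge0 => nu _; exact: sqr_ge0.
Qed.

Let kap := Num.sqrt kap2.

Lemma rest_eval_le g N x : Sobolev m g -> x \in `[0, 1] ->
  `|rst g N x| <= kap * snorm m lam (rst g N).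
Proof.
move=> gS x01; have rS : Sobolev m (rst g N) by exact: Sobolev_rest.
apply: ler_sqr_ge0; first by rewrite mulr_ge0 ?sqrtr_ge0 ?snorm_ge0.
rewrite real_normK ?num_real// exprMn snorm_sqr// sqr_sqrtr ?kap2_ge0//.
exact: eval_le.
Qed.

(** * Deterministic inequalities for a fixed sample *)

Section Sample.
Variables (n : nat) (n1 : (1 <= n)%N) (X : 'I_n -> R).
Hypothesis X01 : forall i, X i \in `[0, 1].

Definition emp_mean g := n%:R^-1 * \sum_(i < n) g (X i).

Lemma emp_mean_sum (I : finType) (F : I -> R -> R) :
  emp_mean (fun x => \sum_(j : I) F j x) = \sum_(j : I) emp_mean (F j).
Proof. by rewrite /emp_mean exchange_big/= mulr_sumr. Qed.

Lemma emp_mean_le g k : (forall x, x \in `[0, 1] -> g x <= k x) -> emp_mean g <= emp_mean k.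
Proof.
move=> gk; rewrite ler_wpM2l ?invr_ge0//; apply: ler_sum => i _; exact: gk.
Qed.

Lemma emp_mean_cst a : emp_mean (fun=> a) = a.
Proof.
rewrite /emp_mean sumr_const card_ord -[a *+ n]mulr_natl mulrA mulVf ?mul1r//.
by rewrite pnatr_eq0 -lt0n.
Qed.

Lemma emp_meanD g k : emp_mean (fun x => g x + k x) = emp_mean g + emp_mean k.
Proof. by rewrite /emp_mean big_split/= mulrDr. Qed.

(* Hilbert-Schmidt norm, restricted to the span of the first [N] basis functions, of the
   difference between the empirical and the population second-moment operators. *)
Definition moment_dev N (p : 'I_N * 'I_N) :=
  emp_mean (fun x => psi p.1 x * psi p.2 x) - Vf (psi p.1) (psi p.2).

(** Cauchy-Schwarz over pairs of indices: the Hilbert-Schmidt norm dominates the quadratic form. *)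
Lemma moment_dev_bound (c : nat -> R) N (eta : R) : 0 <= eta ->
  sqn (@moment_dev N) <= eta ^+ 2 ->
  `|emp_mean (fun x => lincomb c psi N x ^+ 2) - Vf (lincomb c psi N) (lincomb c psi N)|
    <= eta * \sum_(nu < N) c nu ^+ 2.
Proof.
move=> eta0 H; apply: ler_sqr_ge0.
  by rewrite mulr_ge0//; apply: sumr_ge0 => nu _; exact: sqr_ge0.
rewrite real_normK ?num_real//.
have -> : emp_mean (fun x => lincomb c psi N x ^+ 2) - Vf (lincomb c psi N) (lincomb c psi N)
   = \sum_(p : 'I_N * 'I_N) (c p.1 * c p.2) * moment_dev p.
  have -> : (fun x => lincomb c psi N x ^+ 2) =
    (fun x => \sum_(p : 'I_N * 'I_N) (c p.1 * c p.2) * (psi p.1 x * psi p.2 x)).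
    apply/funext => x; rewrite -(pair_bigA _ (fun i j : 'I_N => (c i * c j) * (psi i x * psi j x)))/=.
    rewrite /lincomb expr2 mulr_suml; apply: eq_bigr => i _; rewrite mulr_sumr.
    by apply: eq_bigr => j _; ring.
  rewrite emp_mean_sum.
  have -> : Vf (lincomb c psi N) (lincomb c psi N) =
      \sum_(p : 'I_N * 'I_N) (c p.1 * c p.2) * Vf (psi p.1) (psi p.2).
    rewrite -(pair_bigA _ (fun i j : 'I_N => (c i * c j) * Vf (psi i) (psi j)))/=.
    have lS := Sobolev_lincomb m1 c N psiS.
    rewrite (bilinear_lincomb m1 c N (Vf_lin_Sobolev m1))//; apply: eq_bigr => i _.
    rewrite VfC (bilinear_lincomb m1 c N (Vf_lin_Sobolev m1))// mulr_sumr.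
    by apply: eq_bigr => j _; rewrite VfC; ring.
  rewrite -sumrB; apply: eq_bigr => p _; rewrite /moment_dev mulrBr; congr (_ - _).
  by rewrite /emp_mean -mulr_sumr mulrCA.
apply: le_trans (cauchy_schwarz_sum _ _) _.
rewrite mulrC exprMn; apply: ler_pM => //; [exact: sqn_ge0| |].
  by apply: sumr_ge0 => p _; exact: sqr_ge0.
rewrite -(pair_bigA _ (fun i j : 'I_N => (c i * c j) ^+ 2))/= expr2 mulr_suml.
apply: ler_sum => i _; rewrite mulr_sumr; apply: ler_sum => j _.
by rewrite exprMn.
Qed.

Lemma emp_norm_lower (g : R -> R) (eta : R) : 0 <= eta -> Sobolev m g ->
  (forall N, sqn (@moment_dev N) <= eta ^+ 2) ->
  (1 - eta) * ip g g <= emp_mean (fun x => g x ^+ 2) + lam * Jf m g g.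
Proof.
move=> eta0 gS H; set s := snorm m lam g.
have s0 : 0 <= s by exact: snorm_ge0.
have s2 : s ^+ 2 = ip g g by rewrite snorm_sqr.
suff : Vf g g - emp_mean (fun x => g x ^+ 2) - eta * ip g g <= 0.
  have E : ip g g = Vf g g + lam * Jf m g g by []; lra.
(* With [g = proj + e], the cost of truncation is [2 V(proj, e) + V(e, e) <= 3 s u] for the
   population mean and [2 |g e| + e^2 <= 3 kap2 s u] pointwise for the empirical one. *)
apply: (le0_cvg0 (C := 3 * s * (1 + kap2)) _ (psi_exp gS)) => N.
set e := rst g N; set u := snorm m lam e.
have u0 : 0 <= u by exact: snorm_ge0.
have us : u <= s by exact: rest_le.
have eS : Sobolev m e by exact: Sobolev_rest.
have pS : Sobolev m (proj g N) by exact: Sobolev_lincomb.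
have u2 : u ^+ 2 = ip e e by rewrite snorm_sqr.
have pp : ip (proj g N) (proj g N) <= s ^+ 2 by rewrite inner_lincomb s2; exact: coef_le.
have D := moment_dev_bound (coef g) eta0 (H N).
have cg := coef_le N gS; rewrite -s2 in cg.
have V1 : Vf g g = Vf (proj g N) (proj g N) + 2 * Vf (proj g N) e + Vf e e.
  have gE : g = (fun x => 1 * proj g N x + 1 * e x).
    by apply/funext => x; rewrite !mul1r; exact: split_proj.
  have lS := Sobolev_lin m1 1 1 pS eS.
  rewrite {1 2}gE (Vf_lin_Sobolev m1)// VfC (VfC e) !(Vf_lin_Sobolev m1)// (VfC e (proj g N)).
  by rewrite !mul1r; ring.
have V2 : Vf (proj g N) e <= s * u.
  apply: ler_sqr_ge0; first by rewrite mulr_ge0.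
  apply: (@le_trans _ _ (Vf (proj g N) (proj g N) * Vf e e)).
    apply: discriminant_le => [|t]; first exact: Vf_ge0.
    have := Vf_ge0 (fun x => t * proj g N x + 1 * e x).
    have lS := Sobolev_lin m1 t 1 pS eS.
    rewrite (Vf_lin_Sobolev m1)// VfC (VfC e) !(Vf_lin_Sobolev m1)// (VfC e (proj g N)).
    by move/le_trans; apply; rewrite le_eqVlt; apply/orP; left; apply/eqP; ring.
  rewrite exprMn; apply: ler_pM; rewrite ?Vf_ge0//.
    by apply: le_trans pp; exact: Vf_le_inner.
  by rewrite u2; exact: Vf_le_inner.
have V3 : Vf e e <= s * u.
  apply: (@le_trans _ _ (ip e e)); first exact: Vf_le_inner.
  by rewrite -u2 expr2; exact: ler_wpM2r.
have E1 : emp_mean (fun x => proj g N x ^+ 2) <=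
    emp_mean (fun x => g x ^+ 2 + 3 * kap2 * s * u).
  apply: emp_mean_le => x x01.
  have ge := rest_eval_le N gS x01; rewrite -/e -/u in ge.
  have gg : `|g x| <= kap * s.
    apply: ler_sqr_ge0; first by rewrite mulr_ge0 ?sqrtr_ge0.
    by rewrite real_normK ?num_real// exprMn s2 sqr_sqrtr ?kap2_ge0//; exact: eval_le.
  have -> : proj g N x = g x - e x by rewrite (split_proj g N x) addrK.
  have kk : kap * kap = kap2 by rewrite -expr2 sqr_sqrtr// kap2_ge0.
  have k0 : 0 <= kap by exact: sqrtr_ge0.
  have P1 : `|g x| * `|e x| <= kap2 * s * u.
    rewrite -kk; apply: (@le_trans _ _ ((kap * s) * (kap * u))); last first.
      by rewrite le_eqVlt; apply/orP; left; apply/eqP; ring.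
    exact: ler_pM.
  have P2 : `|e x| * `|e x| <= kap2 * s * u.
    rewrite -kk; apply: (@le_trans _ _ ((kap * s) * (kap * u))); last first.
      by rewrite le_eqVlt; apply/orP; left; apply/eqP; ring.
    apply: ler_pM => //; apply: le_trans ge _; exact: ler_wpM2l.
  have P3 : - (g x * e x) <= `|g x| * `|e x| by rewrite -normrM -normrN ler_norm.
  have P4 : e x * e x <= `|e x| * `|e x| by rewrite -normrM ler_norm.
  have -> : (g x - e x) ^+ 2 = g x ^+ 2 + 2 * (- (g x * e x)) + e x * e x by ring.
  lra.
rewrite emp_meanD emp_mean_cst in E1.
move: D; rewrite ler_norml => /andP[D _].
have D2 := ler_wpM2l eta0 cg.
rewrite V1 -s2.
have su : 0 <= s * u by rewrite mulr_ge0.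
have -> : 3 * s * (1 + kap2) * u = 3 * (s * u) + 3 * kap2 * s * u by ring.
lra.
Qed.

Definition noise_coef (e : 'I_n -> R) N (nu : 'I_N) :=
  n%:R^-1 * \sum_(i < n) e i * psi nu (X i).

Lemma noise_le (e : 'I_n -> R) g (w : R) : 0 <= w -> Sobolev m g ->
  (forall N, sqn (@noise_coef e N) <= w ^+ 2) ->
  n%:R^-1 * \sum_(i < n) e i * g (X i) <= w * snorm m lam g.
Proof.
move=> w0 gS H; rewrite -subr_le0.
apply: (le0_cvg0 (C := n%:R^-1 * (\sum_(i < n) `|e i|) * kap) _ (psi_exp gS)) => N.
have -> : n%:R^-1 * \sum_(i < n) e i * g (X i) =
    \sum_(nu < N) ip g (psi nu) * noise_coef e nu + n%:R^-1 * \sum_(i < n) e i * rst g N (X i).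
  transitivity (n%:R^-1 * \sum_(i < n) e i * proj g N (X i) +
      n%:R^-1 * \sum_(i < n) e i * rst g N (X i)).
    rewrite -mulrDr -big_split/=; congr (_ * _); apply: eq_bigr => i _.
    by rewrite -mulrDr -split_proj.
  congr (_ + _); rewrite /noise_coef.
  under [RHS]eq_bigr do rewrite mulrCA mulr_sumr.
  rewrite -mulr_sumr exchange_big/=; congr (_ * _); apply: eq_bigr => i _.
  by rewrite /lincomb mulr_sumr; apply: eq_bigr => nu _; ring.
have A1 : \sum_(nu < N) ip g (psi nu) * noise_coef e nu <= w * snorm m lam g.
  apply: ler_sqr_ge0; first by rewrite mulr_ge0 ?snorm_ge0.
  apply: le_trans (cauchy_schwarz_sum _ _) _.
  rewrite mulrC exprMn snorm_sqr//; apply: ler_pM => //.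
  - exact: sqn_ge0.
  - by apply: sumr_ge0 => nu _; exact: sqr_ge0.
  - exact: H.
  - exact: coef_le.
have A2 : n%:R^-1 * \sum_(i < n) e i * rst g N (X i) <=
    n%:R^-1 * (\sum_(i < n) `|e i|) * kap * snorm m lam (rst g N).
  rewrite -!mulrA ler_wpM2l ?invr_ge0// mulr_suml; apply: ler_sum => i _.
  apply: le_trans (ler_norm _) _; rewrite normrM ler_wpM2l//.
  exact: rest_eval_le.
lra.
Qed.

(** A single comparison with [f] would leave a factor 2 on the right-hand side. The estimator is
    compared instead with [fh - t D], on the segment towards [f], and the first-order term in [t] is
    kept. *)
Lemma penalized_basic_ineq (f fh : R -> R) (e : 'I_n -> R) :
  Sobolev m f -> Sobolev m fh ->
  (forall g, Sobolev m g ->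
     objective m lam (fun i => f (X i) + e i) X g <=
     objective m lam (fun i => f (X i) + e i) X fh) ->
  emp_mean (fun x => (fh \- f) x ^+ 2) + lam * Jf m (fh \- f) (fh \- f) <=
  n%:R^-1 * \sum_(i < n) e i * (fh \- f) (X i) - lam * Jf m f (fh \- f).
Proof.
move=> fS fhS fhmax; set D := fh \- f.
have DE : D = (fun x => 1 * fh x + (- 1) * f x).
  by apply/funext => x; rewrite /D /= mul1r mulN1r.
have DS : Sobolev m D by rewrite DE; exact: Sobolev_lin.
have JD : Jf m D D = Jf m fh D - Jf m f D.
  by rewrite {1}DE (Jf_lin m1)// mul1r mulN1r.
have nn : n%:R != 0 :> R by rewrite pnatr_eq0 -lt0n.
suff : 0 <= n%:R^-1 * (\sum_(i < n) (e i - D (X i)) * D (X i)) - lam * Jf m fh D.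
  under eq_bigr do rewrite mulrBl -expr2.
  rewrite big_split/= sumrN mulrDr mulrN -/(emp_mean (fun x => D x ^+ 2)) JD; lra.
apply: (@affine_ge0 _ _ (2^-1 * (emp_mean (fun x => D x ^+ 2) + lam * Jf m D D))) => t t0.
have gS := Sobolev_lin m1 1 (- t) fhS DS.
have := fhmax _ gS; rewrite /objective.
have -> : Jf m (fun x => 1 * fh x + - t * D x) (fun x => 1 * fh x + - t * D x) =
   Jf m fh fh - 2 * t * Jf m fh D + t ^+ 2 * Jf m D D.
  by rewrite (Jf_lin m1)// JfC (JfC m D) !(Jf_lin m1)// (JfC m D fh); ring.
have -> : \sum_(i < n) (f (X i) + e i - (1 * fh (X i) + - t * D (X i))) ^+ 2 =
   \sum_(i < n) (f (X i) + e i - fh (X i)) ^+ 2 +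
   (2 * t * (\sum_(i < n) (e i - D (X i)) * D (X i)) + t ^+ 2 * \sum_(i < n) D (X i) ^+ 2).
  rewrite !mulr_sumr -!big_split/=; apply: eq_bigr => i _; rewrite /D /=; ring.
rewrite invfM /emp_mean mulrDr.
move: (\sum_(i < n) (f (X i) + e i - fh (X i)) ^+ 2) => S0.
move: (\sum_(i < n) (e i - D (X i)) * D (X i)) (\sum_(i < n) D (X i) ^+ 2) => S1 S2.
move: (n%:R^-1) => q H.
nra.
Qed.

Lemma spline_error_bound (f fh : R -> R) (e : 'I_n -> R) (eta w : R) :
  0 <= eta -> 0 <= w ->
  Sobolev m f -> Jf m f f <= 1 -> Sobolev m fh ->
  (forall g, Sobolev m g ->
     objective m lam (fun i => f (X i) + e i) X g <=
     objective m lam (fun i => f (X i) + e i) X fh) ->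
  (forall N, sqn (@moment_dev N) <= eta ^+ 2) ->
  (forall N, sqn (@noise_coef e N) <= w ^+ 2) ->
  (1 - eta) * snorm m lam (fh \- f) <= w + h ^+ m.
Proof.
move=> eta0 w0 fS fJ fhS fhmax Hd Hn.
have := penalized_basic_ineq fS fhS fhmax; set D := fh \- f => basic.
have DE : D = (fun x => 1 * fh x + (- 1) * f x).
  by apply/funext => x; rewrite /D /= mul1r mulN1r.
have DS : Sobolev m D by rewrite DE; exact: Sobolev_lin.
have low := emp_norm_lower eta0 DS Hd.
have noi := noise_le w0 DS Hn.
set s := snorm m lam D in noi *.
have s0 : 0 <= s by exact: snorm_ge0.
have s2 : s ^+ 2 = ip D D by rewrite snorm_sqr.
(* Cauchy-Schwarz for [Jf], with [Jf m f f <= 1] and [lam = (h ^+ m) ^+ 2]. *)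
have bias : - (lam * Jf m f D) <= h ^+ m * s.
  apply: ler_sqr_ge0; first by rewrite mulr_ge0// exprn_ge0// ltW.
  have hm2 : (h ^+ m) ^+ 2 = lam by rewrite -exprM mulnC.
  rewrite sqrrN (exprMn 2 lam) (exprMn 2 (h ^+ m)) hm2 s2 expr2 -mulrA ler_pM2l//.
  apply: (@le_trans _ _ (lam * Jf m D D)); last exact: Jf_le_inner.
  rewrite ler_pM2l//; apply: le_trans (Jf_cs m1 fS DS) _.
  by rewrite -[leRHS]mul1r ler_wpM2r// Jf_ge0.
have H : (1 - eta) * s * s <= (w + h ^+ m) * s by move: low; rewrite -s2 expr2; lra.
have [->|sn] := eqVneq s 0; first by rewrite mulr0 addr_ge0// exprn_ge0// ltW.
by move: H; rewrite ler_pM2r// lt_neqAle eq_sym sn.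
Qed.

End Sample.

End RKHS.

(** * Tail bounds for the empirical second moments and the noise *)

Section Markov.
Context {R : realType} d (T : measurableType d) (P : probability T R).
Local Open Scope ereal_scope.

Lemma exp_markov (E : set T) (f : T -> R) (b c : R) : measurable E ->
  measurable_fun setT f -> (forall t, 0 <= f t)%R ->
  (forall t, E t -> expR c <= f t)%R ->
  \int[P]_t (f t)%:E <= (expR b)%:E -> P E <= (expR (b - c))%:E.
Proof.
move=> mE mf f0 fc fb.
have : (expR c)%:E * P E <= (expR b)%:E.
  apply: le_trans fb; rewrite -[E]setIT -integral_indic// -ge0_integralZl_EFin ?expR_ge0//; last first.
    by apply/measurable_EFinP; exact: measurable_indic.
  apply: ge0_le_integral => //.
  - by apply: measurable_funeM; apply/measurable_EFinP; exact: measurable_indic.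
  - exact/measurable_EFinP.
  - move=> t _; rewrite -EFinM lee_fin indicE; case: (boolP (t \in E)) => tE.
      by rewrite mulr1; apply: fc; rewrite inE in tE.
    by rewrite mulr0.
have fE : P E \is a fin_num by exact: fin_num_measure.
rewrite -(fineK fE).
rewrite -EFinM !lee_fin expRD expRN ler_pdivlMr ?expR_gt0//.
by rewrite mulrC.
Qed.

End Markov.

Section UniformLaw.
Context {R : realType} d (T : measurableType d) (P : probability T R).
Notation mu := (@lebesgue_measure R).
Variable X : T -> R.
Hypothesis mX : measurable_fun setT X.
Hypothesis lawX : forall A : set R, measurable A ->
  P (X @^-1` A) = uniform_prob (@ltr01 R) A.

(** The transfer of laws is for nonnegative integrands, so [g] is shifted by its bound [B] and the
    shift is removed afterwards. *)
Lemma integral_uniform_law (g : R -> R) (B : R) : measurable_fun setT g ->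
  (forall x, `|g x| <= B) ->
  (\int[P]_t (g (X t))%:E = (Rintegral mu `[0, 1] g)%:E)%E.
Proof.
move=> mg gB.
have igX : P.-integrable setT (EFin \o (fun t => g (X t))).
  by apply: (@bounded_integrable_prob _ _ _ P _ B); [exact: measurableT_comp mg mX|move=> t].
have ig : mu.-integrable `[0, 1] (EFin \o g).
  apply: measurable_bounded_integrable => //.
  - by rewrite [X in (X < _)%E]lebesgue_measure01 ltry.
  - exact: measurable_funTS.
  - exists B; split; first by rewrite num_real.
    by move=> x Bx t _; apply: (le_trans (gB t)); exact: ltW.
have gB0 x : 0 <= g x + B by have := gB x; rewrite ler_norml => /andP[]; lra.
have mgB : measurable_fun setT (fun x => (g x + B)%:E).
  by apply/measurable_EFinP; exact: measurable_funD.
have := @integral_law _ _ _ P _ (measurableTypeR R) X (uniform_prob (@ltr01 R)) _ mX lawX mgB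
  (fun x => gB0 x).
rewrite integral_uniform// subr0 invr1 mul1e.
have iB : P.-integrable setT (cst B%:E).
  exact: (@bounded_integrable_prob _ _ _ P (cst B) `|B|).
have iB' : mu.-integrable `[0, 1] (cst B%:E).
  apply: (@continuous_compact_integrable R (fun=> B)); first exact: segment_compact.
  by apply: continuous_subspaceT => x; exact: cst_continuous.
rewrite (@integralD _ _ _ P _ _ (EFin \o (fun t => g (X t))) (cst B%:E))//.
rewrite (@integralD _ _ _ mu _ _ (EFin \o g) (cst B%:E))//.
have e1 : (\int[P]_x (cst B%:E) x = B%:E)%E.
  by rewrite integral_cst//= probability_setT mule1.
have e2 : (\int[mu]_(x in (`[0%R, 1%R]%classic : set R)) (cst B%:E) x = B%:E)%E.
  by rewrite integral_cst// [X in (_ * X)%E]lebesgue_measure01 mule1.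
rewrite e1 e2.
have f1 := integrable_fin_num measurableT igX.
have f2 : (\int[mu]_(x in (`[0%R, 1%R]%classic : set R)) (EFin \o g) x)%E \is a fin_num.
  by apply: integrable_fin_num ig.
move=> H; have := congr1 (fun z => (z - B%:E)%E) H; rewrite !addeK// => ->.
by rewrite /Rintegral fineK.
Qed.

End UniformLaw.

Section Tails.
Context {R : realType} d (T : measurableType d) (P : probability T R).
Variables (n : nat) (n1 : (1 <= n)%N) (X eps : 'I_n -> T -> R).
Notation Z := (fun k : ('I_n + 'I_n)%type => match k with inl i => X i | inr i => eps i end).
Hypothesis mX : forall i, measurable_fun setT (X i).
Hypothesis meps : forall i, measurable_fun setT (eps i).
Hypothesis lawX : forall i (A : set R), measurable A ->
  P (X i @^-1` A) = uniform_prob (@ltr01 R) A.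
Hypothesis laweps : forall i (A : set R), measurable A ->
  P (eps i @^-1` A) = normal_prob 0 1 A.
Hypothesis indepZ : mutually_independent P Z.
Variables (psi : nat -> R -> R) (k2 : R).
Hypothesis mpsi : forall nu, measurable_fun setT (psi nu).
Hypothesis psi_le : forall N x, \sum_(nu < N) psi nu x ^+ 2 <= k2.
Hypothesis psi_V : forall i j, i != j -> Vf (psi i) (psi j) = 0.
Hypothesis V_le1 : forall nu, Vf (psi nu) (psi nu) <= 1.
Hypothesis V_le : forall N, \sum_(nu < N) Vf (psi nu) (psi nu) <= k2.
Hypothesis k2_ge1 : 1 <= k2.

Let mZ k : measurable_fun setT (Z k). Proof. by case: k. Qed.
Let k20 : 0 < k2. Proof. exact: lt_le_trans k2_ge1. Qed.
Let n0 : 0 < n%:R :> R. Proof. by rewrite ltr0n. Qed.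

Lemma measurable_moment_dev d' (T' : measurableType d') (Y : 'I_n -> T' -> R) N :
  (forall i, measurable_fun setT (Y i)) ->
  measurable_fun setT (fun t => sqn (@moment_dev R psi n (Y ^~ t) N)).
Proof.
move=> mY; apply: measurable_sum => p; apply: measurable_funX.
apply: measurable_funB => //; apply: measurable_funM => //.
apply: measurable_sum => i; apply: measurable_funM.
  exact: measurableT_comp (mpsi _) (mY i).
exact: measurableT_comp (mpsi _) (mY i).
Qed.

Lemma measurable_noise_coef d' (T' : measurableType d') (Y e : 'I_n -> T' -> R) N :
  (forall i, measurable_fun setT (Y i)) -> (forall i, measurable_fun setT (e i)) ->
  measurable_fun setT (fun t => sqn (@noise_coef R psi n (Y ^~ t) (e ^~ t) N)).
Proof.
move=> mY me; apply: measurable_sum => p; apply: measurable_funX.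
apply: measurable_funM => //.
apply: measurable_sum => i; apply: measurable_funM => //.
exact: measurableT_comp (mpsi _) (mY i).
Qed.

Section Moment.
Variables (N : nat) (eta : R).
Hypotheses (eta0 : 0 < eta) (eta1 : eta <= 1).

(** Since [beta = 2 k2 theta], the exponent per observation is [10 k2^2 theta^2 - theta eta]; this
    [theta] minimises it, with minimum [- eta^2 / (40 k2^2)]. *)
Let theta := eta / (20 * k2 ^+ 2).

Let theta0 : 0 < theta. Proof. by rewrite divr_gt0 ?mulr_gt0 ?exprn_gt0. Qed.

Let zeta x (p : 'I_N * 'I_N) :=
  theta * (psi p.1 x * psi p.2 x - Vf (psi p.1) (psi p.2)).

Let beta := 2 * k2 * theta.

Let psi_sqr_le nu x : psi nu x ^+ 2 <= k2.
Proof.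
apply: le_trans (psi_le nu.+1 x); rewrite big_ord_recr/= lerDr.
by apply: sumr_ge0 => i _; exact: sqr_ge0.
Qed.

(** The tensor of [psi(x)] with itself has norm [sum psi_nu(x)^2 <= k2]. Its mean is diagonal, with
    entries at most 1 and trace at most [k2], so its norm is at most [k2] as well. *)
Let zeta_le x : sqn (zeta x) <= beta ^+ 2.
Proof.
have H1 : \sum_(p : 'I_N * 'I_N) (psi p.1 x * psi p.2 x) ^+ 2 <= k2 ^+ 2.
  rewrite -(pair_bigA _ (fun i j : 'I_N => (psi i x * psi j x) ^+ 2))/=.
  under eq_bigr do under eq_bigr do rewrite exprMn.
  under eq_bigr do rewrite -mulr_sumr.
  rewrite -mulr_suml -expr2 ler_pXn2r ?nnegrE ?(ltW k20) ?psi_le//.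
  by rewrite sumr_ge0// => i _; exact: sqr_ge0.
have H2 : \sum_(p : 'I_N * 'I_N) Vf (psi p.1) (psi p.2) ^+ 2 <= k2 ^+ 2.
  rewrite -(pair_bigA _ (fun i j : 'I_N => Vf (psi i) (psi j) ^+ 2))/=.
  apply: (@le_trans _ _ (\sum_(i < N) Vf (psi i) (psi i))).
    apply: ler_sum => i _; rewrite (bigD1 i)//= big1 ?addr0 => [|j ji].
      by rewrite expr2 -[leRHS]mulr1 ler_wpM2l ?Vf_ge0.
    by rewrite psi_V ?expr0n// eq_sym.
  by apply: le_trans (V_le N) _; rewrite expr2 ler_peMl// ltW.
apply: (@le_trans _ _ (\sum_(p : 'I_N * 'I_N) theta ^+ 2 *
    (2 * (psi p.1 x * psi p.2 x) ^+ 2 + 2 * Vf (psi p.1) (psi p.2) ^+ 2))).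
  apply: ler_sum => p _; rewrite exprMn ler_wpM2l ?sqr_ge0//.
  have := sqr_ge0 (psi p.1 x * psi p.2 x + Vf (psi p.1) (psi p.2)); lra.
have -> : beta ^+ 2 = theta ^+ 2 * (4 * k2 ^+ 2) by rewrite /beta; ring.
rewrite -mulr_sumr ler_wpM2l ?sqr_ge0// big_split/= -!mulr_sumr; lra.
Qed.

Lemma moment_dev_tail :
  (P [set t | (eta ^+ 2 < sqn (@moment_dev R psi n (X ^~ t) N))%R] <=
  (expR (1 - n%:R * eta ^+ 2 / (40 * k2 ^+ 2)))%:E)%E.
Proof.
pose s : seq ('I_n + 'I_n) := map inl (enum 'I_n).
have us : uniq s by rewrite map_inj_uniq ?enum_uniq// => i j [].
have sumE t p : \sum_(k <- s) zeta (Z k t) p =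
    theta * n%:R * @moment_dev R psi n (X ^~ t) N p.
  rewrite big_map big_enum/= /zeta -mulr_sumr -mulrA; congr (_ * _).
  rewrite /moment_dev /emp_mean mulrBr mulVKf ?gt_eqF// sumrB; congr (_ - _).
  by rewrite sumr_const card_ord mulr_natl.
have mz p : measurable_fun setT (zeta ^~ p).
  apply: measurable_funM => //; apply: measurable_funB => //.
  exact: measurable_funM.
have beta0 : 0 <= beta.
  by rewrite /beta; apply: mulr_ge0 (ltW theta0); apply: mulr_ge0 (ltW k20).
have betaE : beta = eta / (10 * k2) by rewrite /beta /theta; field; rewrite gt_eqF.
have beta2 : beta <= 2^-1.
  by rewrite betaE ler_pdivrMr ?mulr_gt0//; have e1 := eta1; have k1 := k2_ge1; lra.
have mgf := integral_expnorm_sum mZ indepZ mz beta0 beta2 zeta_le us.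
have ns : size s = n by rewrite size_map size_enum_ord.
apply: le_trans (exp_markov (b := 1 + 5 / 2 * beta ^+ 2 * n%:R) (c := theta * n%:R * eta)
  (f := fun t => expnorm (fun p => \sum_(k <- s) zeta (Z k t) p)) _ _ _ _ _) _.
- exact: measurable_gt_set (measurable_moment_dev N mX).
- apply: measurable_expnorm => p; apply: measurable_sum => k.
  exact: measurableT_comp (mz p) (mZ k).
- by move=> t; exact: expR_ge0.
- move=> t /= tE; rewrite /expnorm ler_expR.
  have c0 : 0 <= theta * n%:R * eta.
    by apply: mulr_ge0 (ltW eta0); apply: mulr_ge0 (ltW theta0) (ltW n0).
  rewrite -[X in X <= _](ger0_norm c0) -sqrtr_sqr.
  apply: ler_wsqrtr.
  rewrite (_ : sqn _ = (theta * n%:R) ^+ 2 * sqn (@moment_dev R psi n (X ^~ t) N)).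
    rewrite exprMn; apply: (@le_trans _ _ ((theta * n%:R) ^+ 2 *
        sqn (@moment_dev R psi n (X ^~ t) N))); last by rewrite lerDr.
    by rewrite ler_wpM2l ?sqr_ge0// ltW.
  by rewrite /sqn mulr_sumr; apply: eq_bigr => p _; rewrite sumE exprMn.
- rewrite -[in X in (_ <= X)%E]ns; apply: mgf => k p /mapP[i _ ->].
  have mg : measurable_fun setT (fun x => psi p.1 x * psi p.2 x).
    exact: measurable_funM.
  have gb x : `|psi p.1 x * psi p.2 x| <= k2.
    apply: ler_sqr_ge0; first exact: ltW.
    rewrite real_normK ?num_real// exprMn [leRHS]expr2.
    by apply: ler_pM; rewrite ?sqr_ge0 ?psi_sqr_le.
  have zb x : `|zeta x p| <= beta.
    apply: ler_sqr_ge0 => //; rewrite real_normK ?num_real//.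
    apply: le_trans (zeta_le x); rewrite /sqn (bigD1 p)//= lerDl.
    by apply: sumr_ge0 => q _; exact: sqr_ge0.
  rewrite (integral_uniform_law (mX i) (lawX i) (mz p) zb); congr EFin.
  have ig : (@lebesgue_measure R).-integrable `[0, 1] (EFin \o (fun x => psi p.1 x * psi p.2 x)).
    apply: measurable_bounded_integrable => //.
    - by rewrite [X in (X < _)%E]lebesgue_measure01 ltry.
    - exact: measurable_funTS.
    - exists k2; split; first by rewrite num_real.
      by move=> x kx t _; apply: (le_trans (gb t)); exact: ltW.
  have iV : (@lebesgue_measure R).-integrable `[0, 1] (EFin \o (fun=> Vf (psi p.1) (psi p.2))).
    apply: (@continuous_compact_integrable R (fun=> Vf (psi p.1) (psi p.2))).
      exact: segment_compact.
    by apply: continuous_subspaceT => x; exact: cst_continuous.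
  rewrite RintegralZl//; last first.
    exact: (@integrableB _ (measurableTypeR R) R _ _ (measurable_itv _) _ _ ig iV).
  rewrite RintegralB// Rintegral_cst// [X in fine X]lebesgue_measure01 mulr1.
  by rewrite subrr mulr0.
- rewrite lee_fin ler_expR /beta /theta le_eqVlt; apply/orP; left; apply/eqP.
  by field; rewrite gt_eqF.
Qed.

End Moment.

Section Noise.
Variables (N : nat) (q : R).
Hypothesis q0 : 0 < q.

(** [B] is twice the bound [q n] on the second-moment matrix of the design: one half absorbs all the
    rank-one terms, the other half is the surviving [beta]. *)
Lemma noise_coef_mgf (x : 'I_n -> R) :
  (forall y : 'rV[R]_N, \sum_(i < n) (\sum_(nu < N) y 0 nu * psi nu (x i)) ^+ 2 <=
     q * n%:R * \sum_(nu < N) y 0 nu ^+ 2) ->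
  (\int[P]_u (expR (n%:R / (4 * q) * sqn (@noise_coef R psi n x (eps ^~ u) N)))%:E <=
    (expR (k2 / (2 * q)))%:E)%E.
Proof.
move=> Hop.
pose s : seq ('I_n + 'I_n) := map inr (enum 'I_n).
have us : uniq s by rewrite map_inj_uniq ?enum_uniq// => i j [].
pose v (k : 'I_n + 'I_n) : 'rV[R]_N :=
  \row_nu (match k with inl _ => 0 | inr i => psi nu (x i) end).
have nn : n%:R != 0 :> R by rewrite gt_eqF.
have qn : q != 0 by rewrite gt_eqF.
pose A : 'M[R]_N := (2 * q * n%:R)^-1%:M.
pose B : 'M[R]_N := (2 * q * n%:R)%:M.
have AT : A^T = A by rewrite tr_scalar_mx.
have AB : A *m B = 1%:M.
  by rewrite -scalar_mxM mulVf// !mulf_neq0.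
have qn0 : 0 < q * n%:R by rewrite mulr_gt0.
have bscal (a : R) (y : 'rV[R]_N) : bform a%:M y y = a * \sum_(nu < N) y 0 nu ^+ 2.
  rewrite bform_dotv mul_mx_scalar dotvZl dotvE; congr (_ * _).
have Bge (y : 'rV[R]_N) : q * n%:R * dotv y y + \sum_(k <- s) dotv y (v k) ^+ 2 <= bform B y y.
  rewrite bscal big_map big_enum/=.
  have -> : dotv y y = \sum_(nu < N) y 0 nu ^+ 2.
    by rewrite dotvE; apply: eq_bigr => nu _; rewrite expr2.
  have -> : \sum_(i < n) dotv y (v (inr i)) ^+ 2 =
      \sum_(i < n) (\sum_(nu < N) y 0 nu * psi nu (x i)) ^+ 2.
    apply: eq_bigr => i _; rewrite dotvE; congr (_ ^+ 2).
    by apply: eq_bigr => nu _; rewrite mxE.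
  have := Hop y; lra.
have law k : k \in s -> forall C : set R, measurable C -> P (Z k @^-1` C) = normal_prob 0 1 C.
  by move=> /mapP[i _ ->]; exact: laweps.
have := integral_expR_bform mZ indepZ us law AT AB qn0 Bge.
have wE u nu : wsum Z v s u 0 nu = n%:R * @noise_coef R psi n x (eps ^~ u) N nu.
  rewrite wsumE big_map big_enum/= /noise_coef mulVKf//.
  by apply: eq_bigr => i _; rewrite mxE.
under eq_integral => u _.
  rewrite bscal.
  have -> : (2 * q * n%:R)^-1 * (\sum_(nu < N) wsum Z v s u 0 nu ^+ 2) / 2 =
     n%:R / (4 * q) * sqn (@noise_coef R psi n x (eps ^~ u) N).
    under eq_bigr do rewrite wE exprMn.
    by rewrite -mulr_sumr -/(sqn _); field; rewrite nn qn.
  over.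
move/le_trans; apply; rewrite lee_fin ler_expR big_map big_enum/=.
apply: (@le_trans _ _ ((\sum_(i < n) k2) / (2 * (q * n%:R)))).
  rewrite ler_wpM2r ?invr_ge0 ?mulr_ge0 ?(ltW q0)//; apply: ler_sum => i _.
  rewrite dotvE (eq_bigr (fun nu : 'I_N => psi nu (x i) ^+ 2)) ?psi_le//.
  by move=> nu _; rewrite !mxE expr2.
rewrite sumr_const card_ord -[k2 *+ n]mulr_natl le_eqVlt; apply/orP; left; apply/eqP.
by field; rewrite nn qn.
Qed.

(** [G] is a design event, so its indicator can multiply the exponential moment before the noise is
    integrated: on [G] the conditional bound holds, off [G] the integrand is 0. *)
Lemma noise_coef_tail (G : set T) (w : R) :
  @measurable _ (g_sigma_algebraType
    (cylinders Z (finset (fun k => if k is inl _ then true else false)))) G ->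
  (forall t, G t -> forall y : 'rV[R]_N,
     \sum_(i < n) (\sum_(nu < N) y 0 nu * psi nu (X i t)) ^+ 2 <=
     q * n%:R * \sum_(nu < N) y 0 nu ^+ 2) ->
  (P (G `&` [set t | (w ^+ 2 < sqn (@noise_coef R psi n (X ^~ t) (eps ^~ t) N))%R]) <=
   (expR (k2 / (2 * q) - n%:R * w ^+ 2 / (4 * q)))%:E)%E.
Proof.
set S1 := finset _; move=> mG Hop.
pose S2 : {set ('I_n + 'I_n)%type} := finset (fun k => if k is inr _ then true else false).
have mGT : measurable G by apply: g_sigma_sub mG; exact: measurable_cylinders.
pose f t u := expR (n%:R / (4 * q) * sqn (@noise_coef R psi n (X ^~ t) (eps ^~ u) N)).
pose F t u : \bar R := (\1_G t * f t u)%:E.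
have mX1 i : measurable_fun [set: g_sigma_algebraType (cylinders Z S1)] (X i).
  by apply: (@measurable_cylinderfun _ _ _ _ Z S1 (inl i)); rewrite inE.
have me2 i : measurable_fun [set: g_sigma_algebraType (cylinders Z S2)] (eps i).
  by apply: (@measurable_cylinderfun _ _ _ _ Z S2 (inr i)); rewrite inE.
have mf d1 d2 (T1 : measurableType d1) (T2 : measurableType d2)
   (Y : 'I_n -> T1 -> R) (e : 'I_n -> T2 -> R) (H : set T1) :
  (forall i, measurable_fun setT (Y i)) -> (forall i, measurable_fun setT (e i)) ->
  measurable H ->
  measurable_fun [set: (T1 * T2)%type] (fun z => \1_H z.1 *
     expR (n%:R / (4 * q) * sqn (@noise_coef R psi n (Y ^~ z.1) (e ^~ z.2) N))).
  move=> mY me mH; apply: measurable_funM.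
    exact: (measurableT_comp (measurable_indic mH) measurable_fst).
  apply: measurableT_comp => //; apply: measurable_funM => //.
  apply: (measurable_noise_coef (Y := fun i z => Y i z.1) (e := fun i z => e i z.2)) => i.
    exact: (measurableT_comp (mY i) measurable_fst).
  exact: (measurableT_comp (me i) measurable_snd).
have int : (\int[P]_t F t t <= (expR (k2 / (2 * q)))%:E)%E.
  rewrite (@integral_disjoint _ _ _ P _ Z mZ indepZ S1 S2 F); last 3 first.
  - by case=> i; rewrite !inE.
  - by apply/measurable_EFinP; exact: mf.
  - by move=> t u; rewrite lee_fin mulr_ge0 ?expR_ge0.
  apply: (@le_trans _ _ (\int[P]_t (expR (k2 / (2 * q)))%:E)%E); last first.
    by rewrite integral_cst//= probability_setT mule1.
  apply: ge0_le_integral => //.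
  - by move=> t _; apply: integral_ge0 => u _; rewrite lee_fin mulr_ge0 ?expR_ge0.
  - apply: (measurable_fun_fubini_tonelli_F (fun z => F z.1 z.2)) => /=.
      by apply/measurable_EFinP; exact: mf.
    by move=> z; rewrite lee_fin mulr_ge0 ?expR_ge0.
  - move=> t _; have [tG|tG] := pselect (G t).
      have := noise_coef_mgf (Hop t tG).
      by under [X in _ -> (X <= _)%E]eq_integral do rewrite /F indicE mem_set// mul1r.
    under eq_integral do rewrite /F indicE memNset// mul0r.
    by rewrite integral0 lee_fin expR_ge0.
have mfd : measurable_fun setT (fun t => \1_G t * f t t).
  apply: measurable_funM; first exact: measurable_indic.
  apply: measurableT_comp => //; apply: measurable_funM => //.
  exact: measurable_noise_coef.
apply: le_trans (exp_markov (b := k2 / (2 * q)) (c := n%:R * w ^+ 2 / (4 * q))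
  (f := fun t => \1_G t * f t t) _ mfd _ _ int) _ => //.
- apply: measurableI => //.
  exact: measurable_gt_set (measurable_noise_coef N mX meps).
- by move=> t; rewrite mulr_ge0 ?expR_ge0.
- move=> t [tG /= tw]; rewrite indicE mem_set// mul1r ler_expR.
  rewrite mulrAC ler_wpM2l// ?ltW//.
  by rewrite divr_gt0// mulr_gt0.
Qed.

End Noise.

End Tails.

(** * The constant A(h) and the final exponent *)

Section Numerics.
Context {R : realType}.
Implicit Types (h K c k s u w x y M r : R).

Lemma cK_ge0 h (K : R -> R -> R) : 0 <= cK h K.
Proof.
rewrite /cK; set E := (X in sup X).
have E0 x : E x -> 0 <= x by move=> [y _ <-]; exact: sqrtr_ge0.
have [hE|] := pselect (has_sup E); last by move/sup_out => ->.
have [[x Ex] ubE] := hE.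
exact: le_trans (E0 x Ex) (ub_le_sup ubE Ex).
Qed.

Lemma Psi_ge0 m x : 0 <= @Psi R m x.
Proof. by apply: Rintegral_ge0 => y _; exact: sqrtr_ge0. Qed.

Lemma tau_gt0 : 0 < @tau R.
Proof. by rewrite sqrtr_gt0 ln_gt0//; lra. Qed.

(** The first term is nonnegative. In the second, [1 + exp y >= 3 / 2] for [y >= 0], so the root of
    the logarithm is at least [tau], and [20 * 2 * sqrt 6 >= 80]. *)
Lemma Ahe_ge80 m c c0 h : 0 < c -> 0 < c0 -> 80 <= Ahe m c c0 h 2.
Proof.
move=> cp c0p.
have t0 := tau_gt0.
have s6 : 2 <= Num.sqrt (6 : R).
  by rewrite -(@ler_pXn2r _ 2)// ?nnegrE ?sqrtr_ge0// sqr_sqrtr//; lra.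
have first_ge0 : 0 <= 32 * Num.sqrt 6 / tau R * c^-1 * c0 ^+ m * h `^ (- ((2 * m%:R - 1) / 2))
    * Psi m (2^-1 * c * c0 ^- m * h `^ ((2 * m%:R - 1) / 2) * 2) :> R.
  rewrite !mulr_ge0 ?Psi_ge0 ?powR_ge0 ?exprn_ge0 ?invr_ge0 ?sqrtr_ge0 ?(ltW cp) ?(ltW c0p)//.
rewrite /Ahe; set z := Num.sqrt (ln _).
have zt : tau R <= z.
  set y := 2 * c0 * _ in z *.
  have y0 : 0 <= y by rewrite !mulr_ge0 ?powR_ge0 ?(ltW c0p).
  have ey := expR_ge1Dx y.
  by apply: ler_wsqrtr; rewrite ler_ln ?posrE; lra.
have : 80 <= 20 * Num.sqrt 6 * 2 / tau R * z :> R.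
  rewrite mulrAC ler_pdivlMr//.
  apply: (@le_trans _ _ (20 * 2 * 2 * tau R)); first by lra.
  by apply: ler_pM; [lra|exact: ltW|lra|exact: zt].
lra.
Qed.

(** Here [k] is [kap2], [N] the sample size, [s] the target exponent and [h2] stands for [h ^+ m].
    If [k >= 3], the part of [w] in [L] suffices: [(1 + u)^2 >= 3 + 2 s] pays for [k / 2.2], and
    [k s >= 3 s] makes up for the lost constants. Otherwise [h2] is bounded below, so [N w^2] is of
    the order of [N], which exceeds [500 k^2 s]. *)
Lemma noise_exponent_le k N s h2 w L u : 1 <= k -> 3 <= k \/ 1 / 27 <= h2 ^+ 2 ->
  0 <= h2 -> 0 <= L -> 1 <= u -> u ^+ 2 = 2 * s -> 0 <= N ->
  N * L ^+ 2 = k * (1 + u) ^+ 2 -> 500 * (k * k * s) <= N ->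
  w = 79 / 100 * h2 + 89 / 100 * L ->
  k / (2 * (11 / 10)) - N * w ^+ 2 / (4 * (11 / 10)) <= - s.
Proof.
move=> k1 cases h20 L0 u1 us N0 NL Ns wE.
have u2 : 1 * 1 <= u * u by apply: ler_pM.
have s2 : 1 / 2 <= s by move: us; rewrite expr2; lra.
have w0 : 0 <= w by rewrite wE; lra.
case: cases => [k3|h27].
- have wL : (89 / 100) ^+ 2 * L ^+ 2 <= w ^+ 2.
    by rewrite -exprMn ler_pXn2r ?nnegrE//; lra.
  have H : (89 / 100) ^+ 2 * (N * L ^+ 2) <= N * w ^+ 2.
    by rewrite mulrCA ler_wpM2l.
  have H2 : 3 + 2 * s <= (1 + u) ^+ 2.
    have -> : (1 + u) ^+ 2 = 1 + 2 * u + u ^+ 2 by ring.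
    rewrite us; lra.
  have H3 : k * (3 + 2 * s) <= N * L ^+ 2 by rewrite NL ler_wpM2l//; lra.
  have H4 : 3 * s <= k * s by rewrite ler_wpM2r//; lra.
  move: (N * L ^+ 2) (N * w ^+ 2) H H3 => Y Z; rewrite mulrDr expr2 => H H3.
  lra.
- have wh : (79 / 100) ^+ 2 * h2 ^+ 2 <= w ^+ 2.
    by rewrite -exprMn ler_pXn2r ?nnegrE//; lra.
  have w2 : 23 / 1000 <= w ^+ 2.
    by apply: le_trans wh; rewrite expr2; lra.
  have kk0 : 0 <= k * k * s by rewrite !mulr_ge0//; lra.
  have H : N * (23 / 1000) <= N * w ^+ 2 by rewrite ler_wpM2l.
  have ks : k * 1 <= k * k by rewrite ler_wpM2l//; lra.
  have k2 : 1 <= k * k by lra.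
  have kks : k * k * (1 / 2) <= k * k * s by rewrite ler_wpM2l//; lra.
  have kks2 : 1 * s <= k * k * s by rewrite ler_wpM2r//; lra.
  move: (N * w ^+ 2) H => Z H.
  lra.
Qed.

End Numerics.

(** * Extension of the basis by zero, and consequences of a small operator deviation *)

Section Restriction.
Context {R : realType}.
Implicit Types (psi : nat -> R -> R).
Notation I01 := (`[0, 1]%classic : set R).

(** The basis is controlled only on the unit interval. Cutting it off there gives functions that are
    Borel on the whole line and obey the trace bound everywhere, as the tail bounds require. *)
Definition restr01 psi nu : R -> R := psi nu \_ I01.

Lemma restr01E psi nu x : x \in `[0, 1] -> restr01 psi nu x = psi nu x.
Proof. by move=> x01; rewrite /restr01 patchE mem_set. Qed.

Lemma Vf_restr01 psi i j : Vf (restr01 psi i) (restr01 psi j) = Vf (psi i) (psi j).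
Proof. by apply: eq_Rintegral => x; rewrite inE => x01; rewrite !restr01E. Qed.

Lemma moment_dev_restr01 psi n (X : 'I_n -> R) N (p : 'I_N * 'I_N) :
  (forall i, X i \in `[0, 1]) -> moment_dev (restr01 psi) X p = moment_dev psi X p.
Proof.
move=> X01; rewrite /moment_dev Vf_restr01; congr (_ * _ - _).
by apply: eq_bigr => i _; rewrite !restr01E.
Qed.

Lemma noise_coef_restr01 psi n (X e : 'I_n -> R) N (nu : 'I_N) :
  (forall i, X i \in `[0, 1]) -> noise_coef (restr01 psi) X e nu = noise_coef psi X e nu.
Proof.
by move=> X01; congr (_ * _); apply: eq_bigr => i _; rewrite restr01E.
Qed.

Lemma sqn_moment_dev_mono psi n (X : 'I_n -> R) N :
  sqn (@moment_dev R psi n X N) <= sqn (@moment_dev R psi n X N.+1).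
Proof.
pose f i j := (emp_mean X (fun x => psi i x * psi j x) - Vf (psi i) (psi j)) ^+ 2.
have f0 i j : 0 <= f i j by exact: sqr_ge0.
have E k : sqn (@moment_dev R psi n X k) = \sum_(i < k) \sum_(j < k) f i j.
  by rewrite /sqn (pair_bigA _ (fun i j : 'I_k => f i j)).
rewrite !E big_ord_recr/= -[leLHS]addr0 lerD//; last by apply: sumr_ge0.
by apply: ler_sum => i _; rewrite big_ord_recr/= lerDl.
Qed.

Lemma sqn_noise_coef_mono psi n (X e : 'I_n -> R) N :
  sqn (@noise_coef R psi n X e N) <= sqn (@noise_coef R psi n X e N.+1).
Proof. by rewrite {2}/sqn big_ord_recr/= lerDl sqr_ge0. Qed.

(** Supplies [q = 1 + eta] for the noise: the population form is at most the identity in the basis,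
    because [Vf] is dominated by [inner]. *)
Lemma second_moment_le m (m1 : (1 <= m)%N) (h : R) (h0 : 0 < h) psi n (n1 : (1 <= n)%N)
    (X : 'I_n -> R) N (eta : R) (y : 'rV[R]_N) :
  (forall nu, Sobolev m (psi nu)) ->
  (forall i j, inner m (h ^+ (2 * m)) (psi i) (psi j) = (i == j)%:R) -> 0 <= eta ->
  sqn (@moment_dev R psi n X N) <= eta ^+ 2 ->
  \sum_(i < n) (\sum_(nu < N) y 0 nu * psi nu (X i)) ^+ 2 <=
     (1 + eta) * n%:R * \sum_(nu < N) y 0 nu ^+ 2.
Proof.
move=> psiS orth eta0 dev.
pose c (k : nat) : R := if insub k is Some nu then y 0 nu else 0.
have cE (nu : 'I_N) : c nu = y 0 nu by rewrite /c valK.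
have D := moment_dev_bound m1 psiS c eta0 dev.
have V : Vf (lincomb c psi N) (lincomb c psi N) <= \sum_(nu < N) c nu ^+ 2.
  rewrite -(inner_lincomb m1 psiS orth); apply: Vf_le_inner.
  by rewrite exprn_gt0.
have n0 : n%:R != 0 :> R by rewrite pnatr_eq0 -lt0n.
have E : \sum_(i < n) (\sum_(nu < N) y 0 nu * psi nu (X i)) ^+ 2 =
   n%:R * emp_mean X (fun x => lincomb c psi N x ^+ 2).
  rewrite /emp_mean mulVKf//; apply: eq_bigr => i _; congr (_ ^+ 2).
  by apply: eq_bigr => nu _; rewrite cE.
have Ey : \sum_(nu < N) y 0 nu ^+ 2 = \sum_(nu < N) c nu ^+ 2.
  by apply: eq_bigr => nu _; rewrite cE.
rewrite E Ey.
have -> : (1 + eta) * n%:R * (\sum_(nu < N) c nu ^+ 2) =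
  n%:R * ((1 + eta) * \sum_(nu < N) c nu ^+ 2) by ring.
rewrite ler_wpM2l//.
by move: D; rewrite ler_norml => /andP[_]; lra.
Qed.

End Restriction.

(** * The measurable exceptional set *)

Section GoodEvent.
Context {R : realType} d (T : measurableType d) (P : probability T R).
Variables (m : nat) (m1 : (1 <= m)%N) (h : R) (h0 : 0 < h).
Variables (n : nat) (n1 : (1 <= n)%N) (X eps : 'I_n -> T -> R).
Notation Z := (fun k : ('I_n + 'I_n)%type => match k with inl i => X i | inr i => eps i end).
Hypothesis mX : forall i, measurable_fun setT (X i).
Hypothesis meps : forall i, measurable_fun setT (eps i).
Hypothesis lawX : forall i (A : set R), measurable A ->
  P (X i @^-1` A) = uniform_prob (@ltr01 R) A.
Hypothesis laweps : forall i (A : set R), measurable A ->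
  P (eps i @^-1` A) = normal_prob 0 1 A.
Hypothesis indepZ : mutually_independent P Z.
Variables (psi : nat -> R -> R) (k2 : R).
Hypothesis psiS : forall nu, Sobolev m (psi nu).
Hypothesis psi_orth : forall i j, inner m (h ^+ (2 * m)) (psi i) (psi j) = (i == j)%:R.
Hypothesis psi_le : forall N x, x \in `[0, 1] -> \sum_(nu < N) psi nu x ^+ 2 <= k2.
Hypothesis psi_V : forall i j, i != j -> Vf (psi i) (psi j) = 0.
Hypothesis V_le : forall N, \sum_(nu < N) Vf (psi nu) (psi nu) <= k2.
Hypothesis k2_ge1 : 1 <= k2.
Variables (eta w s : R).
Hypotheses (eta0 : 0 < eta) (eta1 : eta <= 1).
Hypothesis moment_exponent : 1 - n%:R * eta ^+ 2 / (40 * k2 ^+ 2) <= - s.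
Hypothesis noise_exponent :
  k2 / (2 * (1 + eta)) - n%:R * w ^+ 2 / (4 * (1 + eta)) <= - s.

Let phi := restr01 psi.

Let mphi nu : measurable_fun setT (phi nu).
Proof.
apply/(measurable_restrictT (psi nu)) => //.
by have [] := Sobolev_L2 m1 (psiS nu).
Qed.

Let phi_le N x : \sum_(nu < N) phi nu x ^+ 2 <= k2.
Proof.
have [x01|x01] := boolP (x \in `[0, 1]).
  rewrite (eq_bigr (fun nu : 'I_N => psi nu x ^+ 2)); first exact: psi_le.
  by move=> nu _; rewrite /phi restr01E.
rewrite big1; first by apply: le_trans k2_ge1.
move=> nu _; rewrite /phi /restr01 patchE memNset ?expr0n//=.
exact/negP.
Qed.

Let D N t := sqn (@moment_dev R phi n (X ^~ t) N).
Let W N t := sqn (@noise_coef R phi n (X ^~ t) (eps ^~ t) N).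
Let G := [set t | forall i, X i t \in `[0, 1]].
Let E N := ~` G `|` ([set t | eta ^+ 2 < D N t] `|` [set t | w ^+ 2 < W N t]).

Let measurable_G d' (T' : measurableType d') (Y : 'I_n -> T' -> R) :
  (forall i, measurable_fun setT (Y i)) ->
  measurable [set t | forall i, Y i t \in `[0, 1]].
Proof.
move=> mY; rewrite (_ : mkset _ = \bigcap_(i in [set: 'I_n]) (Y i @^-1` `[0, 1]%classic)).
  apply: fin_bigcap_measurable => // i _.
  by rewrite -[X in measurable X]setTI; exact: mY.
by apply/seteqP; split => [t Yt i _|t Yt i]; [exact: Yt|exact: (Yt i I)].
Qed.

Let mE N : measurable (E N).
Proof.
apply: measurableU; first by apply: measurableC; exact: measurable_G.
apply: measurableU; apply: measurable_gt_set.
  exact: measurable_moment_dev.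
exact: measurable_noise_coef.
Qed.

Let PG : P (~` G) = 0%E.
Proof.
have mI : measurable (~` `[0, 1]%classic : set R) by exact: measurableC.
have null i : P (X i @^-1` (~` `[0, 1]%classic)) = 0%E.
  rewrite lawX//.
  have P1 : uniform_prob (@ltr01 R) `[0, 1]%classic = 1%E by exact: integral_uniform_pdf1.
  apply: (eq_trans (probability_setC (uniform_prob (@ltr01 R)) (measurable_itv _))).
  by rewrite [X in (_ - X)%E]P1 subee.
apply: (@measure_negligible _ _ _ P); first by apply: measurableC; exact: measurable_G.
have sub : ~` G `<=` \big[setU/set0]_(i <- enum 'I_n) (X i @^-1` (~` `[0, 1]%classic)).
  move=> t /existsNP[i Xi]; rewrite -bigcup_seq; exists i => //=.
  by rewrite mem_enum.
apply: negligibleS sub _.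
elim: (enum 'I_n) => [|i r IH]; first by rewrite big_nil; exact: negligible_set0.
rewrite big_cons; apply: negligibleU => //.
exists (X i @^-1` (~` `[0, 1]%classic)); split => //; last exact: null.
by rewrite -[Y in measurable Y]setTI; exact: mX.
Qed.

(** The noise tail holds only for a well-behaved design, so the noise event is intersected with
    [GN]; outside [GN] one is already in one of the other two sets. *)
Let PE N : (P (E N) <= (2 * expR (- s))%:E)%E.
Proof.
pose GN := G `&` [set t | D N t <= eta ^+ 2].
have mGN : @measurable _ (g_sigma_algebraType
    (cylinders Z (finset (fun k => if k is inl _ then true else false)))) GN.
  have mXc i : measurable_fun [set: g_sigma_algebraType
      (cylinders Z (finset (fun k => if k is inl _ then true else false)))] (X i).
    by apply: (@measurable_cylinderfun _ _ _ _ Z _ (inl i)); rewrite inE.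
  apply: measurableI; first exact: measurable_G.
  rewrite (_ : mkset _ = ~` [set t | eta ^+ 2 < D N t]).
    by apply: measurableC; apply: measurable_gt_set; exact: measurable_moment_dev.
  by apply/seteqP; split => t /=; [rewrite leNgt => /negP|move/negP; rewrite -leNgt].
have q0 : 0 < 1 + eta by rewrite addr_gt0.
have mZ k : measurable_fun setT (Z k) by case: k.
have mGNT : measurable GN by apply: g_sigma_sub mGN; exact: measurable_cylinders.
have noi := noise_coef_tail n1 mX meps laweps indepZ mphi phi_le q0 w mGN.
have mom : (P [set t | (eta ^+ 2 < D N t)%R] <=
    (expR (1 - n%:R * eta ^+ 2 / (40 * k2 ^+ 2)))%:E)%E.
  apply: (moment_dev_tail n1 mX meps lawX indepZ mphi phi_le _ _ _ k2_ge1 N eta0 eta1).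
  - by move=> i j ij; rewrite Vf_restr01 psi_V.
  - move=> nu; rewrite Vf_restr01; apply: (@le_trans _ _ (inner m (h ^+ (2 * m)) (psi nu) (psi nu))).
      by apply: Vf_le_inner; rewrite exprn_gt0.
    by rewrite psi_orth eqxx.
  - move=> N'; rewrite (eq_bigr (fun nu : 'I_N' => Vf (psi nu) (psi nu))) => [|nu _]; first exact: V_le.
    exact: Vf_restr01.
have {}noi : (P (GN `&` [set t | (w ^+ 2 < W N t)%R]) <=
    (expR (k2 / (2 * (1 + eta)) - n%:R * w ^+ 2 / (4 * (1 + eta))))%:E)%E.
  apply: noi => t [tG tD] y.
  have dev : sqn (@moment_dev R psi n (X ^~ t) N) <= eta ^+ 2.
    apply: le_trans tD; rewrite /D /sqn le_eqVlt; apply/orP; left; apply/eqP.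
    by apply: eq_bigr => p _; rewrite moment_dev_restr01.
  have := second_moment_le m1 h0 n1 y psiS psi_orth (ltW eta0) dev.
  apply: le_trans; rewrite le_eqVlt; apply/orP; left; apply/eqP.
  apply: eq_bigr => i _; congr (_ ^+ 2); apply: eq_bigr => nu _.
  by rewrite /phi restr01E.
have mD : measurable [set t | eta ^+ 2 < D N t].
  by apply: measurable_gt_set; exact: measurable_moment_dev.
have mW : measurable [set t | w ^+ 2 < W N t].
  by apply: measurable_gt_set; exact: measurable_noise_coef.
have mGW : measurable (GN `&` [set t | w ^+ 2 < W N t]) by exact: measurableI.
have mG : measurable (~` G) by apply: measurableC; exact: measurable_G.
have sub : E N `<=` ~` G `|` ([set t | eta ^+ 2 < D N t] `|` (GN `&` [set t | w ^+ 2 < W N t])).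
  move=> t [tG|[tD|tW]]; [by left|by right; left|].
  have [tG|tG] := pselect (G t); last by left.
  have [tD|tD] := leP (D N t) (eta ^+ 2); last by right; left.
  by right; right.
have mU1 := measurableU _ _ mD mGW; have mU := measurableU _ _ mG mU1.
apply: (@le_trans _ _ (P (~` G) + (P [set t | (eta ^+ 2 < D N t)%R] +
    P (GN `&` [set t | (w ^+ 2 < W N t)%R])))%E).
  apply: (@le_trans _ _ (P (~` G `|` ([set t | (eta ^+ 2 < D N t)%R] `|`
      (GN `&` [set t | (w ^+ 2 < W N t)%R]))))%E); first by apply: le_measure; rewrite ?inE.
  apply: le_trans (measureU2 _ mG mU1) _; rewrite leeD2l//.
  exact: measureU2.
rewrite PG add0e (_ : 2 * expR (- s) = expR (- s) + expR (- s)); last by ring.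
rewrite EFinD; apply: leeD.
  by apply: (le_trans mom); rewrite lee_fin ler_expR.
by apply: (le_trans noi); rewrite lee_fin ler_expR.
Qed.

Lemma good_event : exists B : set T, [/\ measurable B, (P B <= (2 * expR (- s))%:E)%E &
  forall t, ~ B t -> [/\ forall i, X i t \in `[0, 1],
     (forall N, sqn (@moment_dev R psi n (X ^~ t) N) <= eta ^+ 2) &
     (forall N, sqn (@noise_coef R psi n (X ^~ t) (eps ^~ t) N) <= w ^+ 2)]].
Proof.
have mU : measurable (\bigcup_N E N) by exact: bigcup_measurable.
exists (\bigcup_N E N); split => //.
- have nd : {homo E : a b / (a <= b)%N >-> (a <= b)%O}.
    apply/nondecreasing_seqP => N; apply/subsetPset => t [tG|[tD|tW]].
    + by left.
    + by right; left; apply: (lt_le_trans tD); exact: sqn_moment_dev_mono.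
    + by right; right; apply: (lt_le_trans tW); exact: sqn_noise_coef_mono.
  have cE := nondecreasing_cvg_mu (mu := P) mE mU nd.
  rewrite -(cvg_lim _ cE)//; apply: lime_le; first by apply/cvg_ex; eexists; exact: cE.
  by near=> N; exact: PE.
- move=> t tE.
  have tN N : ~ E N t by move=> EN; apply: tE; exists N.
  have X01 i : X i t \in `[0, 1].
    by apply: contrapT => Xi; apply: (tN 0%N); left => /(_ i).
  split => // N; rewrite leNgt; apply/negP => H; apply: (tN N); right; [left|right].
    rewrite /= /D; apply: (lt_le_trans H); rewrite le_eqVlt; apply/orP; left; apply/eqP.
    by apply: eq_bigr => p _; rewrite moment_dev_restr01.
  rewrite /= /W; apply: (lt_le_trans H); rewrite le_eqVlt; apply/orP; left; apply/eqP.
  by apply: eq_bigr => p _; rewrite noise_coef_restr01.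
Unshelve. all: end_near. Qed.

End GoodEvent.

Unset Implicit Arguments. Set Strict Implicit. Set Printing Implicit Defensive.

Theorem theorem3p1 (R : realType) (m n : nat) (hm : (1 <= m)%N) (hn : (1 <= n)%N)
  (h r M : R) (hh : 0 < h) (hr : 0 < r) (hM : 0 < M)
  (hA1 : A1 m (h ^+ (2 * m)))
  (K : R -> R -> R) (hK : reproducing_kernel m (h ^+ (2 * m)) K)
  (c0 : R) (hc0pos : 0 < c0) (hc0 : entropy_const m h (cK h K) c0)
  (hAh : (cK h K) ^+ 2 * Num.sqrt M * r * h `^ (- 2^-1)
           * Ahe m (cK h K) c0 h 2 <= 2^-1)
  (fhat : ('I_n -> R) -> ('I_n -> R) -> R -> R)
  (hfhat : forall Y X : 'I_n -> R,
     Sobolev m (fhat Y X) /\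
     (forall g, Sobolev m g ->
        objective m (h ^+ (2 * m)) Y X g <= objective m (h ^+ (2 * m)) Y X (fhat Y X)))
  (f : R -> R) (hf : Sobolev m f) (hJf : Jf m f f <= 1)
  (d : measure_display) (T : measurableType d) (P : probability T R)
  (X eps : 'I_n -> T -> R)
  (hXmeas : forall i, measurable_fun setT (X i))
  (hemeas : forall i, measurable_fun setT (eps i))
  (hXlaw : forall i (A : set R), measurable A ->
     P (X i @^-1` A) = uniform_prob (@ltr01 R) A)
  (helaw : forall i (A : set R), measurable A ->
     P (eps i @^-1` A) = normal_prob 0 1 A)
  (hindep : mutually_independent P
     (fun k : ('I_n + 'I_n)%type => match k with inl i => X i | inr i => eps i end)) :
  (outerP P [set w | (delta_n m n h (cK h K) M r <=
      snorm m (h ^+ (2 * m))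
        (fhat (fun i => f (X i w) + eps i w) (fun i => X i w) \- f))%R]
   <= (2 * expR (- (M * n%:R * h * r ^+ 2)))%:E)%E.
Proof.
set rho := M * n%:R * h * r ^+ 2.
have le1 (A : set T) : (outerP P A <= 1)%E.
  rewrite -(@probability_setT _ _ _ P); apply: ereal_inf_lbound.
  by exists setT => //; split.
(* For [rho <= 1/2] the claimed bound is trivial, as [2 exp (- rho) >= 2 (1 - rho) >= 1]. *)
have [rho2|rho2] := leP rho (1 / 2).
  apply: (le_trans (le1 _)); rewrite lee_fin.
  by have := expR_ge1Dx (- rho); lra.
have lam0 : 0 < h ^+ (2 * m) by rewrite exprn_gt0.
have [psi [psiS orth psiV psiexp psibnd]] := orthonormal_basis hm lam0 hA1.
set kap2 := cK h K ^+ 2 / h.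
have k1 : 1 <= kap2 := kap2_ge1 hm hh hK psiS psiexp psibnd.
have k3 : 3 <= kap2 \/ 1 / 27 <= h ^+ (2 * m) := kap2_ge3 hm hh hK psiS psiexp psibnd.
have kap0 : 0 <= kap2 := le_trans ler01 k1.
have c2 : cK h K ^+ 2 = kap2 * h by rewrite /kap2 divfK ?gt_eqF.
have psi_le N x : x \in `[0, 1] -> \sum_(nu < N) psi nu x ^+ 2 <= kap2.
  exact: (sum_psi_le hm hh hK psiS orth psiexp psibnd).
have V_le N : \sum_(nu < N) Vf (psi nu) (psi nu) <= kap2.
  exact: (sum_Vf_le hm hh hK psiS orth psiexp psibnd).
move: kap2 k1 k3 kap0 c2 psi_le V_le => kap2 k1 k3 kap0 c2 psi_le V_le.
have cp : 0 < cK h K.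
  rewrite lt_neqAle cK_ge0 andbT eq_sym -sqrf_eq0 c2 mulf_eq0 negb_or !gt_eqF//.
  exact: lt_le_trans k1.
have n0 : 0 < n%:R :> R by rewrite ltr0n.
have hpow : h `^ (- 2^-1) = (Num.sqrt h)^-1 by rewrite powRN powR12_sqrt// ltW.
have sh0 : 0 < Num.sqrt h by rewrite sqrtr_gt0.
have shh : Num.sqrt h * Num.sqrt h = h by rewrite -expr2 sqr_sqrtr// ltW.
have sM0 : 0 < Num.sqrt M by rewrite sqrtr_gt0.
have sMM : Num.sqrt M * Num.sqrt M = M by rewrite -expr2 sqr_sqrtr// ltW.
(* Since [cK^2 = kap2 h], the hypothesis reads [kap2 sqrt (M h) r A(h) <= 1/2], and [A(h) >= 80].
   Squaring and multiplying by [n] gives [Nlarge]. *)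
have key : kap2 * (Num.sqrt h * Num.sqrt M * r) * 160 <= 1.
  have := Ahe_ge80 m h cp hc0pos => A80.
  have p0 : 0 <= kap2 * (Num.sqrt h * Num.sqrt M * r).
    by rewrite !mulr_ge0 ?sqrtr_ge0 ?(ltW hr).
  have E : cK h K ^+ 2 * Num.sqrt M * r * h `^ (- 2^-1) = kap2 * (Num.sqrt h * Num.sqrt M * r).
    by rewrite hpow c2 -[X in kap2 * X]shh; field; rewrite gt_eqF.
  have := ler_wpM2l p0 A80; move: hAh; rewrite E; lra.
have key2 : (kap2 * kap2 * (M * h * r ^+ 2)) * (160 * 160) <= 1.
  have -> : kap2 * kap2 * (M * h * r ^+ 2) * (160 * 160) =
     (kap2 * (Num.sqrt h * Num.sqrt M * r) * 160) ^+ 2.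
    transitivity (kap2 * kap2 * ((Num.sqrt M * Num.sqrt M) * (Num.sqrt h * Num.sqrt h) *
      r ^+ 2) * (160 * 160)); first by rewrite sMM shh.
    ring.
  by rewrite expr_le1// !mulr_ge0 ?sqrtr_ge0 ?(ltW hr).
have Nlarge : kap2 * kap2 * rho * (160 * 160) <= n%:R.
  have -> : kap2 * kap2 * rho * (160 * 160) =
    n%:R * (kap2 * kap2 * (M * h * r ^+ 2) * (160 * 160)) by rewrite /rho; ring.
  by rewrite -[leRHS]mulr1 ler_wpM2l// ltW.
pose L := cK h K * (Num.sqrt (2 * M) * r + (n%:R * h) `^ (- 2^-1)).
pose u := Num.sqrt (2 * M) * r * Num.sqrt (n%:R * h).
have nh0 : 0 < n%:R * h by rewrite mulr_gt0.
have snh : 0 < Num.sqrt (n%:R * h) by rewrite sqrtr_gt0.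
have LE : L = cK h K / Num.sqrt (n%:R * h) * (1 + u).
  rewrite /L /u powRN powR12_sqrt ?(ltW nh0)//.
  by field; rewrite gt_eqF.
have u0 : 0 <= u by rewrite !mulr_ge0 ?sqrtr_ge0 ?(ltW hr).
have u2 : u ^+ 2 = 2 * rho.
  rewrite /u !exprMn !sqr_sqrtr ?(ltW nh0)//; last by rewrite mulr_ge0 ?(ltW hM).
  by rewrite /rho; ring.
have u1 : 1 <= u.
  by apply: ler_sqr_ge0 => //; rewrite expr1n u2; lra.
have L0 : 0 <= L by rewrite LE mulr_ge0 ?divr_ge0 ?sqrtr_ge0 ?cK_ge0//; lra.
have NL : n%:R * L ^+ 2 = kap2 * (1 + u) ^+ 2.
  rewrite LE !exprMn exprVn sqr_sqrtr ?(ltW nh0)// c2.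
  by field; rewrite !gt_eqF.
(* The error is at most [(w + h^m) / (9/10)], which must stay below [delta_n = 2 h^m + L]. This
   allows [w < 8/10 h^m + 9/10 L]; the missing hundredths make the final contradiction strict. *)
pose w := 79 / 100 * h ^+ m + 89 / 100 * L.
have hm0 : 0 < h ^+ m by rewrite exprn_gt0.
have w0 : 0 <= w by rewrite addr_ge0// mulr_ge0//; lra.
have hm2 : (h ^+ m) ^+ 2 = h ^+ (2 * m) by rewrite -exprM mulnC.
have rho0 : 0 <= rho by lra.
have kr0 : 0 <= kap2 * kap2 * rho := mulr_ge0 (mulr_ge0 kap0 kap0) rho0.
have noise_exp : kap2 / (2 * (1 + 1 / 10)) - n%:R * w ^+ 2 / (4 * (1 + 1 / 10)) <= - rho.
  have -> : 1 + 1 / 10 = 11 / 10 :> R by field.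
  have k3' : 3 <= kap2 \/ 1 / 27 <= (h ^+ m) ^+ 2 by rewrite hm2.
  have N500 : 500 * (kap2 * kap2 * rho) <= n%:R by apply: le_trans Nlarge; lra.
  exact: (noise_exponent_le k1 k3' (ltW hm0) L0 u1 u2 (ltW n0) NL N500 erefl).
have kk0 : 0 < kap2 ^+ 2 by rewrite exprn_gt0//; apply: lt_le_trans k1.
(* The subtracted term is at least [6.4 rho], because [160^2 / 4000 = 6.4]; the surplus covers the
   1, as [rho > 1/2]. *)
have moment_exp : 1 - n%:R * (1 / 10) ^+ 2 / (40 * kap2 ^+ 2) <= - rho.
  have : rho * (160 * 160 / 4000) <= n%:R * (1 / 10) ^+ 2 / (40 * kap2 ^+ 2).
    rewrite ler_pdivlMr; last exact: mulr_gt0.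
    have -> : rho * (160 * 160 / 4000) * (40 * kap2 ^+ 2) =
      kap2 * kap2 * rho * (160 * 160) * (1 / 10) ^+ 2 by field.
    by rewrite ler_wpM2r// sqr_ge0.
  lra.
have e0 : 0 < 1 / 10 :> R by lra.
have e1 : 1 / 10 <= 1 :> R by lra.
have [B [mB PB HB]] := good_event hm hh hn hXmeas hemeas hXlaw helaw hindep psiS orth
  psi_le psiV V_le k1 e0 e1 moment_exp noise_exp.
apply: (@le_trans _ _ (P B)) => //.
apply: ereal_inf_lbound; exists B => //; split => // t /= Ht.
apply: contrapT => /HB [X01 Hd Hn].
have [fS fmax] := hfhat (fun i => f (X i t) + eps i t) (fun i => X i t).
have := spline_error_bound hm hh hK psiS orth psiexp psibnd hn X01 (ltW e0) w0
  hf hJf fS fmax Hd Hn.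
move: Ht; rewrite /delta_n -/L.
set sn := snorm _ _ _ => Ht H.
have : w = 79 / 100 * h ^+ m + 89 / 100 * L by [].
lra.
Qed.
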